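(* Let $B(0,r_0)\subset\mathbb{R}^{n+1}$ and let $\Gamma\subset\mathbb{R}^{n+1}$ be a Lipschitz graph through the origin with slope at most $\tau$ (with respect to $\mathbb{R}^n\times\{0\}$). Let $B\subset B(0,r_0)$ be a ball of radius at most $\frac1{10}\,r_0$ such that $\operatorname{dist}(B,\Gamma)\geq 100\,\tau\, r_0$. Let $K\subset B$ and $G\subset\Gamma$ both be compact sets. Then, for any $s>1$, $$\operatorname{Cap}_s(K)\,\frac{\mathcal{H}^n(G)^2}{r_0^n}\leq C(\tau)\int_G\int_0^\infty\operatorname{Cap}_{s-1}(K\cap S(z,r))\,dr\,d\mathcal{H}^n(z),$$ where $C(\tau)$ is a constant depending only on $\tau$ and the dimension $n$.
   Context: Here $n\geq1$, $r_0>0$, $B(x,r)$ is the open ball in $\mathbb{R}^{n+1}$ with center $x$ and radius $r$, $S(z,r)=\partial B(z,r)\subset\mathbb{R}^{n+1}$, and $\mathcal{H}^n$ is $n$-dimensional Hausdorff measure. A Lipschitz graph with slope at most $\tau$ with respect to $\mathbb{R}^n\times\{0\}$ is a set $\{(y,A(y)):y\in\mathbb{R}^n\}$ with $A:\mathbb{R}^n\to\mathbb{R}$ Lipschitz with constant at most $\tau$. For $t>0$ and a compact set $K\subset\mathbb{R}^{n+1}$, $\operatorname{Cap}_t(K)=\big(\inf_\mu\iint|x-y|^{-t}\,d\mu(x)\,d\mu(y)\big)^{-1}$, where the infimum is over all probability measures $\mu$ supported on $K$ (so that $\operatorname{Cap}_t(K)=0$ if every such energy is infinite or $K=\varnoth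ing$).
   Formalization: The formal theorem assumes G ⊂ Γ ∩ B(0,r_0) rather than only G ⊂ Γ, and τ > 0: the inequality fails for a large ball G in a flat Γ (left side grows like M^{2n}, right like M^n), and no constant exists for τ = 0. *)

(* Defs.v *)
From HB Require Import structures.
From mathcomp Require Import all_boot all_order all_algebra.
From mathcomp Require Import all_classical all_reals all_analysis.

Set Implicit Arguments.
Unset Strict Implicit.
Unset Printing Implicit Defensive.

Import Order.TTheory GRing.Theory Num.Theory.
Import numFieldNormedType.Exports.

Local Open Scope classical_set_scope.
Local Open Scope ring_scope.

(* R^m is 'rV[R]_m.  The norm that the library puts on matrices is the sup
   norm, so the Euclidean norm and everything metric is defined here; the
   library topology on 'rV[R]_m is the Euclidean one. *)

Definition enorm (R : realType) (m : nat) (x : 'rV[R]_m) : R :=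
  Num.sqrt (\sum_(i < m) x 0 i ^+ 2).

Definition eball (R : realType) (m : nat) (x : 'rV[R]_m) (r : R) :
  set 'rV[R]_m := [set y | enorm (y - x) < r].

Definition esphere (R : realType) (m : nat) (x : 'rV[R]_m) (r : R) :
  set 'rV[R]_m := closure (eball x r) `\` interior (eball x r).

Definition set_dist (R : realType) (m : nat) (A B : set 'rV[R]_m) : \bar R :=
  ereal_inf [set (enorm (a - b))%:E | a in A & b in B].

Definition lipschitz_graph (R : realType) (n : nat) (tau : R)
    (Gamma : set 'rV[R]_(n + 1)) : Prop :=
  exists2 A : 'rV[R]_n -> R,
    (forall x y, `|A x - A y| <= tau * enorm (x - y)) &
    Gamma = [set row_mx y (A y)%:M | y in [set: 'rV[R]_n]].

(* R^m with its Borel sigma-algebra *)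
Definition borelRV (R : realType) (m : nat) :=
  g_sigma_algebraType (@open 'rV[R]_m).

(* The 0 makes the diameter of the empty set 0 instead of -oo. *)
Definition ediam (R : realType) (m : nat) (U : set 'rV[R]_m) : \bar R :=
  ereal_sup ([set 0%E] `|` [set (enorm (x - y))%:E | x in U & y in U]).

Definition hausdorff_content (R : realType) (m d : nat) (delta : R)
    (A : set 'rV[R]_m) : \bar R :=
  ereal_inf [set (\sum_(0 <= k <oo) ediam (U k) ^+ d)%E |
    U in [set U : (set 'rV[R]_m)^nat |
      A `<=` \bigcup_k U k /\ forall k, (ediam (U k) <= delta%:E)%E]].

(* d-dimensional Hausdorff (outer) measure for d >= 1, normalized with
   diam^d and no dimensional constant.  It is a measure on the Borel sets,
   which are the only sets on which an integral over borelRV evaluates it. *)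
Definition hausdorff (R : realType) (m d : nat) (A : set (borelRV R m)) :
    \bar R :=
  ereal_sup [set hausdorff_content d delta (A : set 'rV[R]_m) |
    delta in [set delta : R | 0 < delta]].

(* |x - y|^(-t), which is +oo on the diagonal; the library power 0 `^ (- t)
   would be 0. *)
Definition riesz_kernel (R : realType) (m : nat) (t : R) (x y : 'rV[R]_m) :
    \bar R :=
  if x == y then +oo%E else (enorm (x - y) `^ (- t))%:E.

Definition riesz_energy (R : realType) (m : nat) (t : R)
    (mu : probability (borelRV R m) R) : \bar R :=
  (\int[mu]_x \int[mu]_y riesz_kernel t x y)%E.

(* In \bar R, inf of the empty set is +oo and (+oo)^-1 = 0.  For closed K,
   supp mu is included in K iff the complement of K is mu-null. *)
Definition Cap (R : realType) (m : nat) (t : R) (K : set 'rV[R]_m) : \bar R :=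
  ((ereal_inf [set riesz_energy t mu |
     mu in [set mu : probability (borelRV R m) R | mu (~` K) = 0%E]])^-1)%E.

(* Main.v *)
(* Let mu be a probability measure on K of finite energy I_s, and for z in G and
   delta > 0 slice K into the shells A(z, r) = {x : |x - z| < r <= |x - z| + delta}.
   Let N be the mu-mass of A(z, r) and J its energy for the kernel |x - y|^(1-s).
   By Fubini the integral of N is delta H(G).  Since B is far from Gamma, the set of
   z in G with | |x - z| - |y - z| | <= delta has measure at most
   C r0^n delta / |x - y|, and the extra factor 1 / |x - y| turns the kernel of
   exponent s - 1 into the one of exponent s: the integral of J is at most
   C r0^n delta^2 I_s.  Now N^2 / J >= 2 b N - b^2 J for every b; with
   b = beta / delta the integral of the right-hand side is at least
   2 beta H(G) - beta^2 C r0^n I_s, and the optimal beta gives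
   H(G)^2 / (C r0^n I_s).  As delta tends to 0, weak limits of the normalized
   restrictions of mu to A(z, r) live on K and S(z, r), so the upper limit of
   2 b N - b^2 J is at most the capacity of that slice. *)

Require Import Defs.
From HB Require Import structures.
From mathcomp Require Import all_boot all_order all_algebra.
From mathcomp Require Import all_classical all_reals all_analysis.
From mathcomp Require Import measurable_realfun ring lra.

Set Implicit Arguments.
Unset Strict Implicit.
Unset Printing Implicit Defensive.

Import Order.TTheory GRing.Theory Num.Theory.
Import numFieldNormedType.Exports.

Local Open Scope classical_set_scope.
Local Open Scope ring_scope.

(** * The Euclidean norm and the Borel sets *)

(** Two obstacles shape the proof. If x - y is nearly vertical, the bisecting hyperplane of x and y
    is nearly parallel to the graph, and a thin slab around it could hold a large piece of the
    graph. The distance [100 * tau * r0] excludes this: the graph and the hyperplane each vary by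
    only a few [tau * r0] over the ball, so the hyperplane, which passes through the midpoint of x
    and y, stays away from the graph. Second, the capacity of a slice is not shown to be measurable
    in (z, r). It enters only as an upper bound, in integrals that are suprema over simple
    functions; whatever Fubini or a limit theorem is applied to is built from shells. The upper
    limit passes through the integral because J >= kap N^2, with kap a lower bound of the kernel on
    K, keeps 2 b N - b^2 J below 1 / kap for every b, although b = beta / delta tends to infinity.
    The subsequence that realizes the upper limit depends on (z, r), so a weak limit is constructed
    for each pair separately, from cell masses on a binary tree. *)

Section euclidean_norm.
Context {R : realType} {m : nat}.
Implicit Types x y z : 'rV[R]_m.

Lemma enorm_ge0 x : 0 <= enorm x. Proof. exact: sqrtr_ge0. Qed.

Lemma enorm_sqr x : enorm x ^+ 2 = \sum_i x 0 i ^+ 2.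
Proof. by rewrite sqr_sqrtr// sumr_ge0// => i _; exact: sqr_ge0. Qed.

Lemma enorm_coord x i : `|x 0 i| <= enorm x.
Proof.
rewrite -sqrtr_sqr ler_wsqrtr// (bigD1 i)//= lerDl.
by apply: sumr_ge0 => j _; exact: sqr_ge0.
Qed.

Lemma enorm_eq0 x : enorm x = 0 -> x = 0.
Proof.
move=> x0; apply/rowP => i; rewrite mxE; apply/eqP.
by rewrite -normr_le0 -x0 enorm_coord.
Qed.

Lemma enormZ (a : R) x : enorm (a *: x) = `|a| * enorm x.
Proof.
rewrite /enorm -sqrtr_sqr -sqrtrM ?sqr_ge0// mulr_sumr.
by congr Num.sqrt; apply: eq_bigr => i _; rewrite mxE exprMn.
Qed.

Lemma enorm0 : enorm (0 : 'rV[R]_m) = 0.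
Proof. by rewrite -(scale0r 0) enormZ normr0 mul0r. Qed.

Lemma enormN x : enorm (- x) = enorm x.
Proof. by rewrite -scaleN1r enormZ normrN1 mul1r. Qed.

Lemma enormC x y : enorm (x - y) = enorm (y - x).
Proof. by rewrite -enormN opprB. Qed.

Lemma cauchy_schwarz x y : `|\sum_i x 0 i * y 0 i| <= enorm x * enorm y.
Proof.
have [x0|x0] := eqVneq (enorm x) 0.
  rewrite x0 mul0r big1 ?normr0// => i _.
  by rewrite (enorm_eq0 x0) mxE mul0r.
rewrite -sqrtr_sqr -[leRHS]ger0_norm ?mulr_ge0 ?enorm_ge0// -sqrtr_sqr.
rewrite ler_wsqrtr// exprMn.
set P := \sum_i _; set X := enorm x ^+ 2; set Y := enorm y ^+ 2.
have X0 : 0 < X by rewrite exprn_gt0// lt_neqAle eq_sym x0 enorm_ge0.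
(* Up to the factor X, this is the squared distance from y to its projection on the line of x. *)
have : 0 <= \sum_i (X * y 0 i - P * x 0 i) ^+ 2.
  by apply: sumr_ge0 => i _; exact: sqr_ge0.
have -> : \sum_i (X * y 0 i - P * x 0 i) ^+ 2 = X * (X * Y - P ^+ 2).
  transitivity (\sum_i (X ^+ 2 * y 0 i ^+ 2 -
      (X * P *+ 2) * (x 0 i * y 0 i) + P ^+ 2 * x 0 i ^+ 2)).
    by apply: eq_bigr => i _; ring.
  rewrite big_split/= sumrB -!mulr_sumr -!enorm_sqr -/P -/X -/Y; ring.
by rewrite pmulr_rge0// subr_ge0.
Qed.

Lemma enormD x y : enorm (x + y) <= enorm x + enorm y.
Proof.
rewrite -[leRHS]ger0_norm ?addr_ge0 ?enorm_ge0// -sqrtr_sqr ler_wsqrtr//.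
have -> : \sum_i (x + y) 0 i ^+ 2 =
    enorm x ^+ 2 + (\sum_i x 0 i * y 0 i) *+ 2 + enorm y ^+ 2.
  rewrite !enorm_sqr -sumrMnl -!big_split/=.
  by apply: eq_bigr => i _; rewrite mxE sqrrD.
rewrite sqrrD lerD2r lerD2l lerMn2r/=.
exact: le_trans (ler_norm _) (cauchy_schwarz _ _).
Qed.

Lemma enorm_triangle z x y : enorm (x - y) <= enorm (x - z) + enorm (z - y).
Proof. by have := enormD (x - z) (z - y); rewrite addrA subrK. Qed.

Lemma enorm_le_sum x : enorm x <= \sum_i `|x 0 i|.
Proof.
have s0 : 0 <= \sum_i `|x 0 i| by apply: sumr_ge0.
rewrite -[leRHS]ger0_norm// -sqrtr_sqr ler_wsqrtr//.
rewrite [leRHS]expr2 mulr_suml; apply: ler_sum => i _.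
rewrite -real_normK ?num_real// expr2 ler_wpM2l// (bigD1 i)//= lerDl.
exact: sumr_ge0.
Qed.

Lemma enorm_le_max x (e : R) : (forall i, `|x 0 i| <= e) -> enorm x <= m%:R * e.
Proof.
move=> xe; apply: (le_trans (enorm_le_sum x)).
apply: (le_trans (ler_sum _ (fun i _ => xe i))).
by rewrite sumr_const card_ord mulr_natl.
Qed.

(** The bridge between the library topology, given by sup-norm balls, and the Euclidean balls of the
    statement. *)
Lemma nbhs_eball x (U : set 'rV[R]_m) :
  nbhs x U <-> exists2 e : R, 0 < e & eball x e `<=` U.
Proof.
split=> [/nbhs_ballP[e /= e0 eU]|[e e0 eU]].
  exists e => // y; rewrite /eball/= => yx; apply: eU; split=> // i j.
  rewrite ord1 /ball/= -normrN opprB (le_lt_trans _ yx)//.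
  by have := enorm_coord (y - x) j; rewrite !mxE.
(* Dividing by [m.+1] instead of [m] makes the final inequality strict and covers m = 0. *)
have m0 : 0 < m.+1%:R :> R by [].
apply/nbhs_ballP; exists (e / m.+1%:R); rewrite /= ?divr_gt0//.
move=> y [_ xy]; apply: eU; rewrite /eball/=.
have : enorm (y - x) <= m%:R * (e / m.+1%:R).
  apply: enorm_le_max => i; have := xy 0 i.
  by rewrite /ball/= -normrN opprB !mxE => /ltW.
move=> /le_lt_trans; apply; rewrite mulrCA gtr_pMr// ltr_pdivrMr// mul1r.
by rewrite ltr_nat.
Qed.

Lemma open_eball x (r : R) : open (eball x r).
Proof.
rewrite openE => y; rewrite /eball/= => yx; apply/nbhs_eball.
exists (r - enorm (y - x)); first by rewrite subr_gt0.
move=> z; rewrite /eball/= ltrBrDr; apply: le_lt_trans.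
exact: enorm_triangle.
Qed.

(** The point y is a limit of points pulled towards x, and every neighbourhood of y has a point
    pushed outwards, so y is in the closure of the ball and not in its interior. For r = 0 the ball
    is empty and so is its boundary. *)
Lemma esphere_superset x (r : R) : 0 < r ->
  [set y | enorm (y - x) = r] `<=` esphere x r.
Proof.
move=> r0 y /= yxr.
have te e : e / (2 * r) * r = e / 2 by field; rewrite gt_eqF.
split.
  move=> U /nbhs_eball[e e0 eU].
  pose t := Num.min (1 / 2) (e / (2 * r)).
  have t0 : 0 < t by rewrite lt_min !divr_gt0 ?mulr_gt0.
  have t1 : t <= 1 / 2 by rewrite /t ge_min lexx.
  have t2 : t <= e / (2 * r) by rewrite /t ge_min lexx orbT.
  exists (y - t *: (y - x)); split.
    rewrite /eball/= (_ : _ - x = (1 - t) *: (y - x)).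
      rewrite enormZ yxr ger0_norm; last lra.
      by rewrite gtr_pMl//; lra.
    by rewrite scalerBl scale1r addrAC.
  apply: eU; rewrite /eball/= addrAC subrr add0r enormN enormZ yxr gtr0_norm//.
  rewrite (le_lt_trans (ler_wpM2r (ltW r0) t2))//.
  by rewrite te; lra.
move=> /nbhs_eball[e e0 eU].
pose t := e / (2 * r).
have t0 : 0 < t by rewrite !divr_gt0 ?mulr_gt0.
have : eball y e (y + t *: (y - x)).
  rewrite /eball/= addrAC subrr add0r enormZ yxr gtr0_norm//.
  by rewrite te; lra.
move=> /eU; rewrite /eball/= (_ : _ - x = (1 + t) *: (y - x)).
  rewrite enormZ yxr gtr0_norm; last lra.
  by rewrite gtr_pMl// => ?; lra.
by rewrite scalerDl scale1r addrAC.
Qed.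

Lemma closed_measurable_rV (F : set 'rV[R]_m) :
  closed F -> measurable (F : set (borelRV R m)).
Proof.
move=> cF; rewrite -[F]setCK; apply: measurableC.
by apply: sub_sigma_algebra; exact: closed_openC.
Qed.

Lemma compact_closed_rV (F : set 'rV[R]_m) : compact F -> closed F.
Proof. by apply: compact_closed; exact: norm_hausdorff. Qed.

Lemma continuous_measurable_rV (f : 'rV[R]_m -> R) : continuous f ->
  measurable_fun setT (f : borelRV R m -> R).
Proof.
move=> cf; apply: (measurability _ (RGenOpens.measurableE R)) => //.
move=> /= _ [_ [a [b ->]] <-]; rewrite setTI; apply: sub_sigma_algebra.
by apply: open_comp => // x _; exact: cf.
Qed.

Lemma measurable_coord i : measurable_fun setT (fun x : borelRV R m => x 0 i : R).
Proof. by apply: continuous_measurable_rV; exact: coord_continuous. Qed.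

(** Expanding in coordinates avoids comparing the product of two Borel sigma-algebras with the Borel
    sigma-algebra of the product, as continuity of the distance on pairs would require. *)
Lemma measurable_enormB d (T : measurableType d) (f g : T -> borelRV R m) :
  measurable_fun setT f -> measurable_fun setT g ->
  measurable_fun setT (fun t => enorm ((f t : 'rV_m) - (g t : 'rV_m)) : R).
Proof.
move=> mf mg.
apply: (@measurableT_comp _ _ _ _ _ _ (@Num.sqrt R)).
  by apply: continuous_measurable_fun; exact: sqrt_continuous.
apply: measurable_sum => i; apply: measurable_funX.
rewrite [X in measurable_fun _ X](_ : _ = fun t => (f t) 0 i - (g t) 0 i).
  by apply: measurable_funB; exact: (measurableT_comp (measurable_coord i)).
by apply/funext => t; rewrite !mxE.
Qed.

End euclidean_norm.

(** * Hausdorff measure *)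

Section hausdorff_content.
Local Open Scope ereal_scope.
Context {R : realType} {m : nat}.
Implicit Types (A B U : set 'rV[R]_m) (delta : R).

Lemma ediam_ge0 U : 0 <= ediam U.
Proof. by apply: ereal_sup_ubound; left. Qed.

Lemma ediam_ub U (x y : 'rV[R]_m) : U x -> U y -> (enorm (x - y)%R)%:E <= ediam U.
Proof. by move=> Ux Uy; apply: ereal_sup_ubound; right; exists x => //; exists y. Qed.

Lemma ediam_le U (e : R) : (0 <= e)%R ->
  (forall x y, U x -> U y -> (enorm (x - y) <= e)%R) -> ediam U <= e%:E.
Proof.
move=> e0 Ue; apply: ge_ereal_sup => _ [->|[x Ux] [y Uy] <-]; rewrite lee_fin//.
exact: Ue.
Qed.

Lemma ediam0 : ediam (set0 : set 'rV[R]_m) = 0.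
Proof. by apply/eqP; rewrite eq_le ediam_ge0 andbT; exact: ediam_le. Qed.

Variable d : nat.

(* [mu_ext] wants set functions on a measurable type; all sets are measurable in
   this one. *)
Definition hausdorff_gauge delta (U : set (g_sigma_algebraType (@setT (set 'rV[R]_m)))) :
    \bar R :=
  if ediam (U : set 'rV[R]_m) <= delta%:E then ediam (U : set 'rV[R]_m) ^+ d.+1 else +oo.

Lemma hausdorff_gauge_ge0 delta U : 0 <= hausdorff_gauge delta U.
Proof. by rewrite /hausdorff_gauge; case: ifPn => // _; rewrite expe_ge0// ediam_ge0. Qed.

(** The value +oo of the gauge on sets of large diameter replaces the size restriction on coverings.
    The content becomes an instance of [mu_ext] and inherits monotonicity and countable
    subadditivity. *)
Lemma hausdorff_contentE delta A :
  hausdorff_content d.+1 delta A = mu_ext (hausdorff_gauge delta) A.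
Proof.
apply/eqP; rewrite eq_le; apply/andP; split; last first.
  apply: ereal_inf_le_tmp => _ [U [AU Ud] <-]; exists U.
    by split => // i; exact: sub_sigma_algebra.
  by apply: eq_eseriesr => i _; rewrite /hausdorff_gauge Ud.
apply: le_ereal_inf_tmp => _ [U [_ AU] <-].
have [Ud|/existsNP[k Udk]] := pselect (forall k, ediam (U k) <= delta%:E).
  apply: ereal_inf_lbound; exists U => //.
  by apply: eq_eseriesr => i _; rewrite /hausdorff_gauge Ud.
rewrite (@eseries_pinfty _ _ _ k)//= ?leey//.
  by move=> n _; rewrite -ltNye (lt_le_trans _ (hausdorff_gauge_ge0 _ _)).
by rewrite /hausdorff_gauge; case: ifPn.
Qed.

Lemma hausdorff_content_ge0 delta A : 0 <= hausdorff_content d.+1 delta A.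
Proof. by rewrite hausdorff_contentE mu_ext_ge0//; exact: hausdorff_gauge_ge0. Qed.

Lemma hausdorff_content_antitone A delta1 delta2 : (delta1 <= delta2)%R ->
  hausdorff_content d.+1 delta2 A <= hausdorff_content d.+1 delta1 A.
Proof.
move=> d12; apply: ereal_inf_le_tmp => _ [U [AU Ud] <-]; exists U => //; split => //.
by move=> k; rewrite (le_trans (Ud k))// lee_fin.
Qed.

(** A covering set of diameter at most delta cannot meet both A and B, so the sets that meet A cover
    A and the others cover B. *)
Lemma hausdorff_content_separated A B (delta e : R) : (delta < e)%R ->
  (forall x y, A x -> B y -> (e <= enorm (x - y))%R) ->
  hausdorff_content d.+1 delta A + hausdorff_content d.+1 delta B <=
  hausdorff_content d.+1 delta (A `|` B).
Proof.
move=> de AB; apply: le_ereal_inf_tmp => _ [U [ABU Ud] <-].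
pose PA k := `[< U k `&` A !=set0 >].
pose UA k := if PA k then U k else set0.
pose UB k := if PA k then set0 else U k.
have d0 (V : set 'rV[R]_m) : 0 <= ediam V ^+ d.+1 by rewrite expe_ge0// ediam_ge0.
have z : (0 : \bar R) ^+ d.+1 = 0 by rewrite expeS mul0e.
rewrite (_ : (\sum_(0 <= k <oo) _) =
    \sum_(0 <= k <oo) (ediam (UA k) ^+ d.+1 + ediam (UB k) ^+ d.+1)); last first.
  apply: eq_eseriesr => k _; rewrite /UA /UB; case: (PA k).
      by rewrite ediam0 z adde0.
  by rewrite ediam0 z add0e.
have delta0 : 0 <= delta%:E by exact: le_trans (ediam_ge0 (U 0%N)) (Ud 0%N).
rewrite nneseriesD//; apply: leeD; apply: ereal_inf_lbound.
  exists UA => //; split.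
    move=> x Ax; have [k _ Ukx] := ABU x (or_introl Ax).
    by exists k => //; rewrite /UA/= /PA asboolT//; exists x.
  by move=> k; rewrite /UA; case: ifP => // _; rewrite ediam0.
exists UB => //; split.
  move=> y By; have [k _ Uky] := ABU y (or_intror By).
  exists k => //; rewrite /UB/= /PA; case: asboolP => // -[x [Ukx Ax]]; exfalso.
  have := le_lt_trans (le_trans (ediam_ub Ukx Uky) (Ud k)) _.
  by move=> /(_ e%:E); rewrite !lte_fin => /(_ de); rewrite ltNge AB.
by move=> k; rewrite /UB; case: ifP => // _; rewrite ediam0.
Qed.

End hausdorff_content.

(** * Hausdorff measure as a metric outer measure and as a Borel measure *)

Section hausdorff_outer_measure.
Local Open Scope ereal_scope.
Context {R : realType} {m d : nat}.
Implicit Types A B : set (borelRV R m).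
Local Notation H := (@hausdorff R m d.+1).

Lemma hausdorff_content_le delta A : (0 < delta)%R ->
  hausdorff_content d.+1 delta (A : set 'rV[R]_m) <= H A.
Proof. by move=> ?; apply: ereal_sup_ubound; exists delta. Qed.

Let hausdorff_ge0 A : 0 <= H A.
Proof.
by apply: (le_trans _ (@hausdorff_content_le 1%R A _)) => //; exact: hausdorff_content_ge0.
Qed.

Let hausdorff0 : H set0 = 0.
Proof.
apply/eqP; rewrite eq_le hausdorff_ge0 andbT; apply: ge_ereal_sup => _ [e e0 <-].
rewrite hausdorff_contentE mu_ext0//; last exact: hausdorff_gauge_ge0.
by rewrite /hausdorff_gauge ediam0 lee_fin ltW// expeS mul0e.
Qed.

Let le_hausdorff : {homo H : A B / A `<=` B >-> A <= B}.
Proof.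
move=> A B AB; apply: ge_ereal_sup => _ [e e0 <-].
apply: (le_trans _ (hausdorff_content_le B e0)).
by rewrite !hausdorff_contentE; exact: le_mu_ext.
Qed.

Let hausdorff_sigma_subadditive : sigma_subadditive H.
Proof.
move=> F; apply: ge_ereal_sup => _ [e e0 <-]; rewrite hausdorff_contentE.
apply: le_trans (mu_ext_sigma_subadditive _ _) _; first exact: hausdorff_gauge_ge0.
apply: lee_nneseries => n _.
  by move=> ?; rewrite -hausdorff_contentE hausdorff_content_ge0.
by rewrite -hausdorff_contentE; exact: hausdorff_content_le.
Qed.

HB.instance Definition _ := isOuterMeasure.Build R (borelRV R m) H
  hausdorff0 hausdorff_ge0 le_hausdorff hausdorff_sigma_subadditive.

Lemma hausdorff_separated A B (e : R) : (0 < e)%R ->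
  (forall x y : 'rV[R]_m, A x -> B y -> (e <= enorm (x - y))%R) ->
  H A + H B <= H (A `|` B).
Proof.
move=> e0 AB; set M := H (A `|` B).
have [->|Moo] := eqVneq M +oo; first by rewrite leey.
have Mfin : M \is a fin_num by rewrite ge0_fin_numE ?hausdorff_ge0// ltey.
have fin (X : set (borelRV R m)) : X `<=` A `|` B -> H X \is a fin_num.
  move=> XAB; rewrite ge0_fin_numE ?hausdorff_ge0//.
  by rewrite (le_lt_trans (le_hausdorff XAB))// ltey.
have fA : H A \is a fin_num by apply: fin; left.
have cfin X delta : (0 < delta)%R -> H X \is a fin_num ->
    hausdorff_content d.+1 delta (X : set 'rV[R]_m) \is a fin_num.
  move=> delta0; rewrite !ge0_fin_numE ?hausdorff_ge0 ?hausdorff_content_ge0//.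
  by apply: le_lt_trans; exact: hausdorff_content_le.
rewrite addeC -leeBrDr//; apply: ge_ereal_sup => _ [e1 /= e10 <-].
rewrite leeBrDr// addeC -leeBrDr; last first.
  by rewrite cfin// fin//; right.
apply: ge_ereal_sup => _ [e2 /= e20 <-].
rewrite leeBrDr; last by rewrite cfin// fin//; right.
(* A common scale: below [e1] and [e2], where contents only grow, and strictly below the gap e. *)
pose e3 := Num.min (Num.min e1 e2) (e / 2)%R.
have e30 : (0 < e3)%R by rewrite !lt_min e10 e20 divr_gt0.
apply: le_trans (hausdorff_content_le _ e30).
apply: le_trans (@hausdorff_content_separated R m d A B e3 e _ AB); last first.
  by rewrite /e3 gt_min; apply/orP; right; rewrite gtr_pMr// invf_lt1// ltr1n.
by apply: leeD; apply: hausdorff_content_antitone; rewrite /e3 !ge_min lexx ?orbT.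
Qed.

(* Caratheodory's criterion: X \ C is exhausted by the shells of X at distance at
   least 1/(k+1) from C; rings two steps apart are at positive distance, so their
   measures add up and form a convergent series when H X is finite. *)
Let shell (X C : set 'rV[R]_m) k : set (borelRV R m) :=
  [set x | X x /\ forall c : 'rV[R]_m, C c -> (k.+1%:R^-1 <= enorm (x - c))%R].

Let shell_sub X C i j : (i <= j)%N -> shell X C i `<=` shell X C j.
Proof.
move=> ij x [Xx xC]; split => // c Cc; apply: le_trans (xC c Cc).
by rewrite lef_pV2 ?posrE// ler_nat.
Qed.

Let shell_separated X C k (Y : set (borelRV R m)) : Y `<=` X `\` shell X C k.+1 ->
  H (shell X C k) + H Y <= H (shell X C k `|` Y).
Proof.
move=> YX; apply: (@hausdorff_separated _ _ (k.+1%:R^-1 - k.+2%:R^-1)%R).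
  by rewrite subr_gt0 ltf_pV2 ?posrE// ltr_nat.
move=> x y [Xx xC] /YX[Xy] /not_andP[//|/existsNP[c /not_implyP[Cc /negP]]].
rewrite -ltNge => yc; have := xC c Cc.
have := enorm_triangle y x c.
by move: (k.+1%:R^-1)%R (k.+2%:R^-1)%R yc => a b; lra.
Qed.

(** Ring n + 1 is separated from shell n, and both lie in shell n + 2. The two terms on the right
    therefore collect the rings of the two parities. *)
Let shell_rings X C n :
  \sum_(0 <= i < n.+1) H (shell X C i.+1 `\` shell X C i) <=
  H (shell X C n.+1) + H (shell X C n).
Proof.
elim: n => [|n ih].
  rewrite big_nat1 -[leLHS]adde0; apply: leeD => //.
  by apply: le_hausdorff => x [].
rewrite big_nat_recr//=; apply: (le_trans (leeD2r _ ih)).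
rewrite -addeA addeC leeD2r//.
apply: (le_trans (@shell_separated X C n _ _)).
  by move=> x [[Xx _] xn]; split.
apply: le_hausdorff => x [xn|[]//].
by apply: (@shell_sub X C n n.+2) => //; exact: leqW.
Qed.

Let shell_tail X C N : closed C ->
  H (X `&` ~` C) <= H (shell X C N) +
    \sum_(N <= i <oo) H (shell X C i.+1 `\` shell X C i).
Proof.
move=> cC.
apply: (@le_trans _ _ (H (shell X C N `|`
    \bigcup_(i in ~` `I_N) (shell X C i.+1 `\` shell X C i)))).
  apply: le_hausdorff => x [Xx xC].
  have [e e0 xe] : exists2 e : R, (0 < e)%R & eball (x : 'rV_m) e `<=` ~` C.
    by apply/nbhs_eball; apply: open_nbhs_nbhs; split => //; exact: closed_openC.
  have ex : exists k, `[< shell X C k x >].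
    exists (Num.truncn e^-1); apply/asboolP; split => // c Cc.
    rewrite leNgt; apply/negP => xc.
    apply: (xe c) => //; rewrite /eball/= enormC (lt_le_trans xc)//.
    by rewrite -[leRHS]invrK lef_pV2 ?posrE ?invr_gt0// ltW// truncnS_gt.
  case: (ex_minnP ex) => k /asboolP xk kmin.
  have [kN|Nk] := leqP k N; first by left; exact: shell_sub xk.
  right; exists k.-1 => /=; first by apply/negP; rewrite -leqNgt -ltnS (ltn_predK Nk).
  rewrite (ltn_predK Nk); split => // /asboolT/kmin.
  by rewrite leqNgt (ltn_predK Nk) leqnn.
apply: (le_trans (outer_measureU2 _ _ _)); apply: leeD2l.
exact: outer_measure_sigma_subadditive_tail.
Qed.

Lemma hausdorff_caratheodory_closed (C : set 'rV[R]_m) :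
  closed C -> H.-caratheodory (C : set (borelRV R m)).
Proof.
move=> cC; apply: le_caratheodory_measurable => X.
suff : H (X `&` C) + H (X `&` ~` C) <= H X by [].
have [->|Xoo] := eqVneq (H X) +oo; first by rewrite leey.
have shellX k : H (shell X C k) <= H X by apply: le_hausdorff => x [].
pose tail N := \sum_(N <= i <oo) H (shell X C i.+1 `\` shell X C i).
have sumoo : \sum_(0 <= i <oo) H (shell X C i.+1 `\` shell X C i) < +oo.
  apply: (@le_lt_trans _ _ (H X + H X)); last by rewrite lte_add_pinfty// ltey.
  apply: lime_le; first exact: is_cvg_nneseries.
  apply: nearW => -[|n]; first by rewrite big_nil adde_ge0.
  by apply: (le_trans (shell_rings _ _ _)); exact: leeD.
have tail0 : tail N @[N --> \oo] --> 0 by exact: nneseries_tail_cvg.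
have lim : H X + tail N @[N --> \oo] --> H X + 0.
  apply: cvgeD => //; first by rewrite fin_num_adde_defl.
  exact: cvg_cst.
rewrite -[leRHS]adde0 -(cvg_lim _ lim)//; apply: lime_ge.
  by apply/cvg_ex; exists (H X + 0).
apply: nearW => N; apply: (le_trans (leeD2l _ (shell_tail X N cC))).
rewrite addeA leeD2r// addeC.
apply: (@le_trans _ _ (H (shell X C N `|` (X `&` C)))); last first.
  by apply: le_hausdorff => x [[]|[]].
apply: (@hausdorff_separated _ _ (N.+1%:R^-1)); first by rewrite invr_gt0.
by move=> x y [_ xC] [_]; exact: xC.
Qed.

Lemma hausdorff_caratheodory (B : set (borelRV R m)) :
  measurable B -> H.-caratheodory B.
Proof.
move: B; apply: smallest_sub.
  split; first exact: caratheodory_measurable_set0.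
    by move=> A mA; rewrite setTD; exact: caratheodory_measurable_setC.
  exact: caratheodory_measurable_bigcup.
move=> U oU; rewrite -[U]setCK; apply: caratheodory_measurable_setC.
by apply: hausdorff_caratheodory_closed; exact: open_closedC.
Qed.

Let hausdorff_semi_sigma_additive : semi_sigma_additive H.
Proof.
move=> F mF tF mUF.
apply: (@caratheodory_measure_sigma_additive _ _ H) => //.
- by move=> i; exact: hausdorff_caratheodory.
- exact: hausdorff_caratheodory.
Qed.

HB.instance Definition _ := isMeasure.Build _ _ _ H
  hausdorff0 hausdorff_ge0 hausdorff_semi_sigma_additive.

End hausdorff_outer_measure.

(** * Transversality *)

Section box_counting.
Context {R : realType} {m d : nat}.
Implicit Types S : set 'rV[R]_m.

Lemma hausdorff_content_finite_cover S (I : finType) (P : I -> set 'rV[R]_m) (D : R) :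
  S `<=` \bigcup_i P i -> (forall i, (ediam (P i) <= D%:E)%E) -> 0 <= D ->
  (hausdorff_content d.+1 D S <= (#|I|%:R * D ^+ d.+1)%:E)%E.
Proof.
move=> SP PD D0; pose U k := nth set0 [seq P i | i <- enum I] k.
have szU : size [seq P i | i <- enum I] = #|I| by rewrite size_map -cardE.
have UD k : (ediam (U k) <= D%:E)%E.
  have [kI|Ik] := ltnP k #|I|; last first.
    by rewrite /U nth_default ?szU// ediam0 lee_fin.
  have i0 : I by case: (enum I) (cardE I) kI => [|i _ _ _] // ->.
  by rewrite /U (nth_map i0) -?cardE.
apply: (@le_trans _ _ (\sum_(0 <= k <oo) ediam (U k) ^+ d.+1)%E).
  apply: ereal_inf_lbound; exists U => //; split => // x /SP[i _ Pix].
  exists (index i (enum I)) => //; rewrite /U (nth_map i) ?index_mem ?mem_enum//.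
  by rewrite nth_index// mem_enum.
have U0 k : (0 <= ediam (U k) ^+ d.+1)%E by rewrite expe_ge0// ediam_ge0.
rewrite (nneseries_split 0 #|I| (fun k _ => U0 k)) [X in (_ + X)%E]eseries0 ?adde0; last first.
  by move=> k Ik _; rewrite /U nth_default ?szU// ediam0 expeS mul0e.
rewrite big_mkord (@le_trans _ _ (\sum_(k < #|I|) (D ^+ d.+1)%:E)%E)//.
  apply: lee_sum => k _; rewrite EFin_expe.
  elim: d.+1 => [|j ih]; rewrite ?expe0// !expeS.
  by apply: lee_pmul => //; [exact: ediam_ge0|exact/expe_ge0/ediam_ge0].
by rewrite sumEFin lee_fin sumr_const card_ord mulr_natl.
Qed.

Lemma truncn_eq_dist (x y : R) : 0 <= x -> 0 <= y ->
  Num.truncn x = Num.truncn y -> `|x - y| <= 1.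
Proof.
move=> x0 y0 xy; have /andP[] := truncn_itv x0; have /andP[] := truncn_itv y0.
rewrite xy ler_norml -natr1; lra.
Qed.

(* The functions p and q are coordinates on S: cells of a grid of step h in p have
   q-extent at most l + B h, hence split into O(l / h) pieces of diameter at
   most L h. *)
Lemma hausdorff_box_count S (p : 'I_d -> 'rV[R]_m -> R) (q : 'rV[R]_m -> R)
    (a L l B : R) :
  0 < a -> 0 < L -> 0 < l -> 0 <= B ->
  (forall j z, S z -> `|p j z| <= a) ->
  (forall (h : R) z1 z2, 0 <= h -> S z1 -> S z2 ->
    (forall j, `|p j z1 - p j z2| <= h) -> `|q z1 - q z2| <= l + B * h) ->
  (forall (h : R) z1 z2, 0 <= h -> S z1 -> S z2 ->
    (forall j, `|p j z1 - p j z2| <= h) -> `|q z1 - q z2| <= h ->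
    enorm (z1 - z2) <= L * h) ->
  (hausdorff d.+1 (S : set (borelRV R m)) <=
    (L ^+ d.+1 * (3 * a) ^+ d * ((3 + 2 * B) * l))%:E)%E.
Proof.
move=> a0 L0 l0 B0 pa ql zL; apply: ge_ereal_sup => _ [e /= e0 <-].
(* With h <= a and h <= l the rounding up of the cell counts is absorbed: h times the counts is at
   most 3 a and (3 + 2 B) l. With h <= e / L the pieces are admissible at scale e. *)
pose h := Num.min (Num.min a l) (e / L).
have h0 : 0 < h by rewrite !lt_min a0 l0 divr_gt0.
have ha : h <= a by rewrite !ge_min lexx.
have hl : h <= l by rewrite !ge_min lexx orbT.
have he : L * h <= e by rewrite mulrC -ler_pdivlMr// !ge_min lexx orbT.
apply: (le_trans (hausdorff_content_antitone _ _ he)).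
pose cell j z := Num.truncn ((p j z + a) / h).
pose N1 := (Num.truncn (2 * a / h)).+1.
(* A point of S in the cell f, from which q is measured inside that cell. The default 0 occurs only
   for cells that S misses. *)
pose base (f : {ffun 'I_d -> 'I_N1}) :=
  xget 0 [set z | S z /\ forall j, cell j z = f j].
pose w := l + B * h.
pose N2 := (Num.truncn (2 * w / h)).+1.
pose cellq f z := Num.truncn ((q z - q (base f) + w) / h).
pose P (i : {ffun 'I_d -> 'I_N1} * 'I_N2) :=
  [set z | [/\ S z, forall j, cell j z = i.1 j & cellq i.1 z = i.2]].
have pp j z : S z -> 0 <= (p j z + a) / h.
  move=> Sz; rewrite divr_ge0 ?(ltW h0)//.
  by have := pa j z Sz; rewrite ler_norml; lra.
have cell_dist z1 z2 : S z1 -> S z2 -> (forall j, cell j z1 = cell j z2) ->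
    forall j, `|p j z1 - p j z2| <= h.
  move=> S1 S2 c12 j; have := truncn_eq_dist (pp j _ S1) (pp j _ S2) (c12 j).
  rewrite -mulrBl normrM (gtr0_norm (x := h^-1)) ?invr_gt0//.
  by rewrite ler_pdivrMr// mul1r opprD addrACA subrr addr0.
have qq (f : {ffun 'I_d -> 'I_N1})  z : S z -> (forall j, cell j z = f j) ->
    0 <= (q z - q (base f) + w) / h <= 2 * w / h.
  move=> Sz zf; have [Sb bf] : S (base f) /\ forall j, cell j (base f) = f j.
    by rewrite /base; case: xgetP => [? -> //|/(_ z)]; apply: contra_notP => _.
  have : `|q z - q (base f)| <= w.
    apply: ql => //; first exact: ltW.
    by apply: cell_dist => // j; rewrite zf bf.
  rewrite ler_norml => /andP[q1 q2]; rewrite divr_ge0 ?(ltW h0)//=; last lra.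
  by rewrite ler_pM2r ?invr_gt0//; lra.
apply: (@le_trans _ _ (#|{: {ffun 'I_d -> 'I_N1} * 'I_N2}|%:R * (L * h) ^+ d.+1)%:E).
  apply: (@hausdorff_content_finite_cover _ _ P); last by rewrite mulr_ge0 ?ltW.
    move=> z Sz.
    have c1 j : (cell j z < N1)%N.
      rewrite ltnS le_truncn// ler_pM2r ?invr_gt0//.
      by have := pa j z Sz; rewrite ler_norml; lra.
    pose f := [ffun j => Ordinal (c1 j)].
    have zf j : cell j z = f j by rewrite ffunE.
    have c2 : (cellq f z < N2)%N.
      by rewrite ltnS le_truncn//; have /andP[] := qq f z Sz zf.
    by exists (f, Ordinal c2).
  move=> [f g]; apply: ediam_le; first by rewrite mulr_ge0 ?ltW.
  move=> x y [/= Sx xf xg] [/= Sy yf yg].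
  apply: zL => //; first exact: ltW.
    by apply: cell_dist => // j; rewrite xf yf.
  have /andP[qx _] := qq f x Sx xf; have /andP[qy _] := qq f y Sy yf.
  have := truncn_eq_dist qx qy (etrans xg (esym yg)).
  rewrite -mulrBl normrM (gtr0_norm (x := h^-1)) ?invr_gt0//.
  rewrite ler_pdivrMr// mul1r (_ : _ - _ = q x - q y)//; ring.
rewrite lee_fin card_prod card_ffun !card_ord natrM natrX.
have w0 : 0 < w by rewrite ltr_wpDr// mulr_ge0// ltW.
have hN1 : h * N1%:R <= 3 * a.
  have : (Num.truncn (2 * a / h))%:R <= 2 * a / h by rewrite truncn_le divr_ge0 ?mulr_ge0 ?ltW.
  have -> : N1%:R = (Num.truncn (2 * a / h))%:R + 1 :> R by rewrite natr1.
  rewrite ler_pdivlMr// [h * (_ + 1)]mulrDr mulr1 [h * _]mulrC; lra.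
have hN2 : h * N2%:R <= (3 + 2 * B) * l.
  have : (Num.truncn (2 * w / h))%:R <= 2 * w / h by rewrite truncn_le divr_ge0 ?mulr_ge0 ?ltW.
  have -> : N2%:R = (Num.truncn (2 * w / h))%:R + 1 :> R by rewrite natr1.
  rewrite ler_pdivlMr// [h * (_ + 1)]mulrDr mulr1 [h * _]mulrC.
  have : B * h <= B * l by rewrite ler_wpM2l.
  rewrite /w; lra.
(* The d + 1 factors h of the piece diameters are shared out among the d + 1 counts, so the bound no
   longer depends on the scale. *)
rewrite [leLHS](_ : _ = L ^+ d.+1 * (h * N1%:R) ^+ d * (h * N2%:R)); last first.
  by rewrite !exprMn !exprS; ring.
rewrite ler_pM ?mulr_ge0 ?exprn_ge0 ?mulr_ge0// ?(ltW h0) ?(ltW L0)//.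
by rewrite ler_wpM2l ?exprn_ge0 ?(ltW L0)// lerXn2r// nnegrE mulr_ge0// ltW.
Qed.

End box_counting.

(** * Pieces of a Lipschitz graph inside a slab *)

Section lipschitz_graph_slab.
Context {R : realType} {k : nat}.
Local Notation n := k.+1.
Variables (A : 'rV[R]_n -> R) (tau : R).
Hypothesis tau0 : 0 < tau.
Hypothesis lipA : forall x y, `|A x - A y| <= tau * enorm (x - y).

Let graph (y : 'rV[R]_n) : 'rV[R]_(n + 1) := row_mx y (A y)%:M.

Lemma enorm_row_mx (y : 'rV[R]_n) (a : R) :
  enorm (row_mx y a%:M : 'rV_(n + 1)) ^+ 2 = enorm y ^+ 2 + a ^+ 2.
Proof.
rewrite !enorm_sqr big_split_ord/= big_ord1; congr (_ + _).
  by apply: eq_bigr => i _; rewrite row_mxEl.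
by rewrite row_mxEr !mxE eqxx mulr1n.
Qed.

Lemma row_mxB_scalar (u v : 'rV[R]_n) (a b : R) :
  row_mx u a%:M - row_mx v b%:M = row_mx (u - v) (a - b)%:M :> 'rV_(n + 1).
Proof. by rewrite opp_row_mx add_row_mx -raddfB. Qed.

Lemma enorm_graphB x y : enorm (graph x - graph y) <= (1 + tau) * enorm (x - y).
Proof.
have xy0 := enorm_ge0 (x - y).
have t0 : 0 <= 1 + tau by rewrite addr_ge0 ?(ltW tau0).
rewrite -(@ler_pXn2r _ 2) ?nnegrE ?enorm_ge0 ?mulr_ge0//.
rewrite /graph row_mxB_scalar enorm_row_mx.
have h : (A x - A y) ^+ 2 <= (tau * enorm (x - y)) ^+ 2.
  by rewrite -real_normK ?num_real// lerXn2r ?nnegrE ?mulr_ge0 ?(ltW tau0).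
apply: (le_trans (lerD (lexx _) h)).
have : 0 <= tau * enorm (x - y) ^+ 2 by rewrite mulr_ge0 ?sqr_ge0 ?ltW.
by rewrite !exprMn; nra.
Qed.

(** The factor that the box count yields for a = 2 r, L = 2 n (1 + tau), B = 3 n and l = 4 W / |e|,
    once r^k and W / |e| are taken out. *)
Definition slab_const : R :=
  (2 * n%:R * (1 + tau)) ^+ n * 6 ^+ k * (3 + 6 * n%:R) * 4.

Lemma slab_const_gt0 : 0 < slab_const.
Proof. by rewrite /slab_const !mulr_gt0 ?exprn_gt0 ?mulr_gt0 ?addr_gt0. Qed.

(* The slab condition fixes the component of y along e up to O(W / |e|); as p one
   takes the coordinates other than i, the largest one of e, of the projection of
   y along e to y_i = 0. *)
Lemma hausdorff_graph_slab (e : 'rV[R]_n) (ev c r W : R) (S : set 'rV[R]_(n + 1)) :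
  0 < r -> 0 < W -> e != 0 -> tau * `|ev| <= enorm e / 2 ->
  (forall z, S z -> exists y, [/\ z = graph y, (forall i, `|y 0 i| <= r) &
     `|\sum_i e 0 i * y 0 i + ev * A y - c| <= W]) ->
  (hausdorff n (S : set (borelRV R (n + 1))) <=
    (slab_const * r ^+ k * (W / enorm e))%:E)%E.
Proof.
move=> r0 W0 e0 tev Sgraph.
have en0 : 0 < enorm e.
  by rewrite lt_neqAle enorm_ge0 andbT eq_sym; apply: contra_neq e0 => /enorm_eq0.
pose i := [arg max_(i > ord0) `|e 0 i|]%O.
have ei j : `|e 0 j| <= `|e 0 i| by rewrite /i; case: arg_maxP => // ? _; apply.
have ei0 : e 0 i != 0.
  apply: contra_neq e0 => ei0; apply/rowP => j; apply/eqP.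
  by rewrite mxE -normr_le0 (le_trans (ei j))// ei0 normr0.
pose t (y : 'rV[R]_n) := y 0 i / e 0 i.
pose v (y : 'rV[R]_n) := y - t y *: e.
pose pr (z : 'rV[R]_(n + 1)) : 'rV[R]_n := lsubmx z.
pose p (j : 'I_k) z := v (pr z) 0 (lift i j).
pose q z := pr z 0 i.
have prg y : pr (graph y) = y by rewrite /pr row_mxKl.
have vi y : v y 0 i = 0 by rewrite !mxE /t divfK// subrr.
have vB x y : v x - v y = v (x - y).
  by apply/rowP => j; rewrite /v /t !mxE; ring.
have vle h z1 z2 : 0 <= h -> (forall j, `|p j z1 - p j z2| <= h) ->
    forall j, `|v (pr z1 - pr z2) 0 j| <= h.
  move=> h0 ph j; case: (unliftP i j) => [j' ->|->]; last by rewrite vi normr0.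
  by have := ph j'; rewrite /p -vB !mxE.
have te y : t y * e 0 i = y 0 i by rewrite /t divfK.
have tei y j : `|t y * e 0 j| <= `|y 0 i|.
  by rewrite -(te y) !normrM ler_wpM2l.
have bound : slab_const * r ^+ k * (W / enorm e) =
    (2 * n%:R * (1 + tau)) ^+ n * (3 * (2 * r)) ^+ k *
    ((3 + 2 * (3 * n%:R)) * (4 * W / enorm e)).
  by rewrite /slab_const (_ : 3 * (2 * r) = 6 * r) ?exprMn; ring.
rewrite bound; apply: (@hausdorff_box_count _ _ _ S p q).
- by rewrite mulr_gt0.
- by rewrite !mulr_gt0 ?addr_gt0.
- by rewrite divr_gt0 ?mulr_gt0.
- by rewrite mulr_ge0.
- move=> j z /Sgraph[y [-> yr _]]; rewrite /p prg !mxE.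
  rewrite (le_trans (ler_normB _ _))// mulr_natl mulr2n lerD//.
  by rewrite (le_trans (tei _ _)).
- move=> h z1 z2 h0 /Sgraph[y1 [-> _ y1W]] /Sgraph[y2 [-> _ y2W]] ph.
  have := vle h _ _ h0 ph; rewrite /q !prg => {}vle.
  set y := y1 - y2; have -> : y1 0 i - y2 0 i = y 0 i by rewrite !mxE.
  have vn : enorm (v y) <= n%:R * h by exact: enorm_le_max.
  have yE : y = v y + t y *: e by rewrite /v subrK.
  have yn : enorm y <= enorm (v y) + `|t y| * enorm e.
    by rewrite {1}yE -enormZ; exact: enormD.
  have eyE : \sum_j e 0 j * y 0 j = \sum_j e 0 j * v y 0 j + t y * enorm e ^+ 2.
    rewrite enorm_sqr mulr_sumr -big_split/=; apply: eq_bigr => j _.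
    by rewrite {1}yE !mxE; ring.
  (* Subtracting the two slab conditions removes c and doubles W. *)
  have ey : `|\sum_j e 0 j * y 0 j + ev * (A y1 - A y2)| <= 2 * W.
    rewrite (_ : _ + _ = (\sum_j e 0 j * y1 0 j + ev * A y1 - c) -
      (\sum_j e 0 j * y2 0 j + ev * A y2 - c)).
      by rewrite (le_trans (ler_normB _ _))// mulr_natl mulr2n lerD.
    rewrite (_ : \sum_j e 0 j * y 0 j =
      \sum_j e 0 j * y1 0 j - \sum_j e 0 j * y2 0 j); first by ring.
    by rewrite -sumrB; apply: eq_bigr => j _; rewrite !mxE; ring.
  have cs := cauchy_schwarz e (v y).
  have eA : `|ev * (A y1 - A y2)| <= enorm e / 2 * enorm y.
    rewrite normrM (le_trans (ler_wpM2l (normr_ge0 _) (lipA _ _)))//.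
    by rewrite mulrA [_ * tau]mulrC ler_wpM2r// enorm_ge0.
  (* Pairing y = v y + t e with e isolates t |e|^2. The graph term is at most |e| |y| / 2 with |y|
     <= |v y| + |t| |e|, so half of |t| |e|^2 is absorbed on the left; this yields the 4 and the
     3. *)
  have key : `|t y| * enorm e <= 4 * W / enorm e + 3 * enorm (v y).
    have : `|t y| * enorm e ^+ 2 <= 2 * W + enorm e * enorm (v y) + enorm e / 2 * enorm y.
      rewrite -{1}(ger0_norm (sqr_ge0 (enorm e))) -normrM.
      rewrite (_ : t y * _ = (\sum_j e 0 j * y 0 j + ev * (A y1 - A y2)) -
        \sum_j e 0 j * v y 0 j - ev * (A y1 - A y2)); last by rewrite eyE; ring.
      rewrite (le_trans (ler_normB _ _))// lerD//.
      by rewrite (le_trans (ler_normB _ _))// lerD.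
    have : enorm e / 2 * enorm y <=
      enorm e / 2 * (enorm (v y) + `|t y| * enorm e) by rewrite ler_wpM2l// ltW ?divr_gt0.
    move=> h1 h2; rewrite -(ler_pM2r en0) mulrDl divfK ?gt_eqF//.
    lra.
  have tei' : `|y 0 i| <= `|t y| * enorm e.
    by rewrite -te normrM ler_wpM2l// enorm_coord.
  rewrite (le_trans tei')// (le_trans key)// lerD2l -mulrA ler_wpM2l//.
(* As the coordinate i of e is the largest, |t e_j| <= |y_i| for all j. Every coordinate of y is
   thus at most 2 h, whence L = 2 n (1 + tau). *)
- move=> h z1 z2 h0 /Sgraph[y1 [-> _ _]] /Sgraph[y2 [-> _ _]] ph.
  have := vle h _ _ h0 ph; rewrite /q !prg => {}vle.
  set y := y1 - y2; have -> : y1 0 i - y2 0 i = y 0 i by rewrite !mxE.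
  move=> yi; rewrite (le_trans (enorm_graphB _ _))//.
  rewrite [leRHS](_ : _ = (1 + tau) * (n%:R * (2 * h))); last by ring.
  rewrite ler_wpM2l ?addr_ge0 ?(ltW tau0)//; apply: enorm_le_max => j.
  rewrite (_ : _ 0 j = v y 0 j + t y * e 0 j); last by rewrite !mxE subrK.
  rewrite (le_trans (ler_normD _ _))// mulr_natl mulr2n lerD//.
  by rewrite (le_trans (tei _ _)).
Qed.

(** The slab of half-width r along the first basis vector contains the whole ball, so the slab
    estimate applies with W = r, |e| = 1 and no vertical component. *)
Lemma hausdorff_graph_ball (r : R) (S : set 'rV[R]_(n + 1)) : 0 < r ->
  S `<=` [set graph y | y in [set: 'rV[R]_n]] `&` eball 0 r ->
  (hausdorff n (S : set (borelRV R (n + 1))) <= (slab_const * r ^+ n)%:E)%E.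
Proof.
move=> r0 SG; pose e : 'rV[R]_n := delta_mx 0 ord0.
have e1 : enorm e = 1.
  rewrite /enorm (bigD1 ord0)//= big1 ?mxE ?eqxx ?expr1n ?addr0 ?sqrtr1// => i i0.
  by rewrite mxE (negbTE i0) andbF expr0n.
rewrite [X in (_ <= X%:E)%E](_ : _ = slab_const * r ^+ k * (r / enorm e)); last first.
  by rewrite e1 divr1 exprSr mulrA.
apply: (@hausdorff_graph_slab e 0 0) => //.
- by apply: contra_eq_neq e1 => ->; rewrite enorm0 eq_sym oner_eq0.
- by rewrite normr0 mulr0 e1.
move=> z /SG[[y _ <-]]; rewrite /eball/= subr0 => yr.
have yi i : `|y 0 i| <= r.
  rewrite (le_trans _ (ltW yr))//.
  by have := enorm_coord (graph y) (lshift 1 i); rewrite /graph row_mxEl.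
exists y; split => //; rewrite mul0r addr0 subr0 (bigD1 ord0)//= big1 ?addr0.
  by rewrite mxE !eqxx mul1r.
by move=> i i0; rewrite mxE (negbTE i0) andbF mul0r.
Qed.

End lipschitz_graph_slab.

(** * Points of the graph almost equidistant from x and y *)

Section transversality.
Context {R : realType} {k : nat}.
Local Notation n := k.+1.

(** Affine in z and zero on the bisecting hyperplane: almost equal distances to x and y force z into
    a slab normal to x - y. *)
Lemma sum_sqr_diff (x y z : 'rV[R]_(n + 1)) :
  enorm (x - z) ^+ 2 - enorm (y - z) ^+ 2 =
  2 * (\sum_i (x - y) 0 i * z 0 i - \sum_i (x - y) 0 i * ((x 0 i + y 0 i) / 2)) * -1.
Proof.
rewrite !enorm_sqr -!sumrB mulr_sumr mulr_suml; apply: eq_bigr => i _.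
by rewrite !mxE; field.
Qed.

Lemma last_coord (z : 'rV[R]_(n + 1)) : z = row_mx (lsubmx z) (z 0 (rshift n ord0))%:M.
Proof.
rewrite -[LHS]hsubmxK; congr row_mx; apply/rowP => i.
by rewrite !ord1 !mxE eqxx mulr1n.
Qed.

Lemma transversality (tau : R) : 0 < tau -> exists2 C : R, 0 < C &
  forall (r0 : R) (Gamma : set 'rV[R]_(n + 1)) (c : 'rV[R]_(n + 1)) (rho : R),
    0 < r0 -> lipschitz_graph tau Gamma -> 0 < rho ->
    eball c rho `<=` eball 0 r0 ->
    ((100 * tau * r0)%:E <= set_dist (eball c rho) Gamma)%E ->
    forall G, G `<=` Gamma `&` eball 0 r0 ->
    (hausdorff n (G : set (borelRV R (n + 1))) <= (C * r0 ^+ n)%:E)%E /\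
    forall x y (delta : R), eball c rho x -> eball c rho y -> x != y -> 0 < delta ->
    (hausdorff n ([set z | G z /\ (`|enorm (x - z) - enorm (y - z)| <= delta)%R]
       : set (borelRV R (n + 1))) <=
      (C * r0 ^+ n * (delta / enorm (x - y)))%:E)%E.
Proof.
(* In the flat case |e| <= (1 + 1 / (2 tau)) |e'| and the slab has half-width 2 delta r0, which
   gives the factor 2 + 1 / tau. In the steep case |e| <= (2 + 1 / tau) delta, and the trivial bound
   for all of G is enough. *)
move=> tau0; have K0 := @slab_const_gt0 R k tau tau0.
set K := slab_const _ in K0; exists (K * (2 + tau^-1)).
  by rewrite mulr_gt0 ?addr_gt0 ?invr_gt0.
have Kle : K <= K * (2 + tau^-1).
  have : 0 < tau^-1 by rewrite invr_gt0.
  by move=> ?; rewrite ler_peMr ?(ltW K0)//; lra.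
move=> r0 Gamma c rho r00 [A lipA GammaA] rho0 cr dist G GG.
have Gball : (hausdorff n (G : set (borelRV R (n + 1))) <= (K * r0 ^+ n)%:E)%E.
  by apply: (@hausdorff_graph_ball _ _ A) => //; rewrite -GammaA.
split.
  by rewrite (le_trans Gball)// lee_fin ler_wpM2r// exprn_ge0// ltW.
move=> x y delta xc yc xy delta0.
set S := [set z | _].
have SG : S `<=` G by move=> z [].
set e := x - y; have e0 : e != 0 by rewrite subr_eq0.
pose e' : 'rV[R]_n := lsubmx e; pose ev := e 0 (rshift n ord0).
pose mid i := (x 0 i + y 0 i) / 2.
have d0 : 0 < enorm e.
  by rewrite lt_neqAle enorm_ge0 andbT eq_sym; apply: contra_neq e0 => /enorm_eq0.
have dE : enorm e <= enorm e' + `|ev|.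
  rewrite -(@ler_pXn2r _ 2) ?nnegrE ?enorm_ge0 ?addr_ge0 ?enorm_ge0//.
  rewrite {1}(last_coord e) enorm_row_mx -/e' -/ev -(real_normK (num_real ev)).
  by have := enorm_ge0 e'; have := normr_ge0 ev; nra.
have dotE (w : 'rV[R]_n) (a : R) : \sum_i e 0 i * (row_mx w a%:M : 'rV_(n + 1)) 0 i =
    \sum_i e' 0 i * w 0 i + ev * a.
  rewrite big_split_ord/= big_ord1 row_mxEr [a%:M _ _]mxE eqxx mulr1n.
  by congr (_ + _); apply: eq_bigr => i _; rewrite row_mxEl [e' _ _]mxE.
pose kap := \sum_i e 0 i * mid i.
have slab z : S z -> exists w, [/\ z = row_mx w (A w)%:M,
    enorm z < r0 & `|\sum_i e' 0 i * w 0 i + ev * A w - kap| <= 2 * delta * r0].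
  move=> [Gz zd]; have [] := GG _ Gz; rewrite GammaA /eball/= subr0 => -[w _ wz] zr.
  exists w; split => //; rewrite -dotE wz.
  have := sum_sqr_diff x y z; rewrite -/e -/kap.
  set D := _ - kap => DE.
  have xz : enorm (x - z) <= 2 * r0.
    have := enormD x (- z); rewrite enormN.
    by have := cr _ xc; rewrite /eball/= subr0; lra.
  have yz : enorm (y - z) <= 2 * r0.
    have := enormD y (- z); rewrite enormN.
    by have := cr _ yc; rewrite /eball/= subr0; lra.
  (* A difference of squares: the distances differ by at most delta and their sum is at most 4
     r0. *)
  have : `|2 * D| <= delta * (4 * r0).
    rewrite -normrN -mulrN1 -DE subr_sqr normrM ler_pM//.
    by rewrite ger0_norm ?addr_ge0 ?enorm_ge0//; lra.
  by rewrite normrM gtr0_norm//; lra.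
(* Either e = x - y is flat enough for the slab estimate, or it is steep; in the
   second case, a point z of S would be far from the bisecting hyperplane unless
   |e| = O(delta), because the midpoint of x and y is far from the graph. *)
have [good|bad] := leP (tau * `|ev|) (enorm e' / 2).
  have e'0 : e' != 0.
    apply: contra_neq e0 => e'z; rewrite (last_coord e) -/e' -/ev e'z.
    suff -> : ev = 0 by rewrite raddf0 row_mx0.
    move: good; rewrite e'z enorm0 mul0r => h; apply/eqP; rewrite -normr_le0.
    by rewrite -(ler_pM2l tau0) mulr0.
  have en0 : 0 < enorm e'.
    by rewrite lt_neqAle enorm_ge0 andbT eq_sym; apply: contra_neq e'0 => /enorm_eq0.
  have := @hausdorff_graph_slab R k A tau tau0 lipA e' ev kap r0 (2 * delta * r0) S.
  move=> /(_ r00) h; apply: (le_trans (h _ e'0 good _)).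
  - by rewrite !mulr_gt0.
  - move=> z /slab[w [zw zr sl]]; exists w; split => // i.
    rewrite (le_trans _ (ltW zr))//.
    by have := enorm_coord z (lshift 1 i); rewrite zw row_mxEl.
  rewrite lee_fin -/K exprSr.
  have : (enorm e')^-1 <= (1 + tau^-1 / 2) / enorm e.
    rewrite ler_pdivlMr// mulrC ler_pdivrMr// (le_trans dE)// mulrDl mul1r lerD2l.
    by rewrite -(ler_pM2l tau0) (le_trans good)// !mulrA mulfV ?gt_eqF// mul1r mulrC.
  move=> h1; rewrite (_ : _ * (2 * delta * r0 / enorm e') =
    2 * (K * (r0 ^+ k * r0) * delta) * (enorm e')^-1); last by ring.
  rewrite (_ : _ * (delta / enorm e) =
    2 * (K * (r0 ^+ k * r0) * delta) * ((1 + tau^-1 / 2) / enorm e)); last by field; rewrite !gt_eqF.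
  apply: ler_wpM2l => //; apply: ltW.
  by rewrite mulr_gt0// mulr_gt0// mulr_gt0// mulr_gt0// exprn_gt0.
have [[z Sz]|Snone] := pselect (S !=set0); last first.
  rewrite (_ : S = set0) ?measure0 ?lee_fin; last first.
    by rewrite -subset0 => z Sz; apply: Snone; exists z.
  apply: ltW; rewrite mulr_gt0 ?divr_gt0// mulr_gt0 ?exprn_gt0// mulr_gt0//.
  by rewrite addr_gt0 ?invr_gt0.
rewrite (le_trans (le_outer_measure _ _ _ SG))// (le_trans Gball)// lee_fin.
have [w [zw zr sl]] := slab z Sz.
pose mv : 'rV[R]_(n + 1) := \row_i mid i.
pose m' : 'rV[R]_n := lsubmx mv; pose ml := mv 0 (rshift n ord0).
have mc : eball c rho mv.
  rewrite /eball/= (_ : mv - c = 2^-1 *: (x - c) + 2^-1 *: (y - c)).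
    apply: (le_lt_trans (enormD _ _)); rewrite !enormZ gtr0_norm ?invr_gt0//.
    by move: xc yc; rewrite /eball/=; lra.
  by apply/rowP => i; rewrite !mxE /mid; field.
(* The midpoint lies in the ball by convexity, and the vertical gap to the graph is the distance to
   one of its points. *)
have far : 100 * tau * r0 <= `|ml - A m'|.
  have /ereal_inf_lbound : [set (enorm (a - b))%:E | a in eball c rho & b in Gamma]
      (enorm (mv - row_mx m' (A m')%:M))%:E.
    exists mv => //; exists (row_mx m' (A m')%:M) => //.
    by rewrite GammaA; exists m'.
  move=> /(le_trans dist); rewrite lee_fin => /le_trans; apply.
  rewrite {1}(last_coord mv) -/m' -/ml row_mxB_scalar.
  rewrite subrr -(@ler_pXn2r _ 2) ?nnegrE ?enorm_ge0// enorm_row_mx enorm0.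
  by rewrite expr0n add0r real_normK ?num_real.
have wm : enorm (w - m') <= 2 * r0.
  apply: (@le_trans _ _ (enorm (z - mv))).
    rewrite zw {1}(last_coord mv) -/m' -/ml row_mxB_scalar.
    by rewrite -(@ler_pXn2r _ 2) ?nnegrE ?enorm_ge0// enorm_row_mx lerDl sqr_ge0.
  have := enormD z (- mv); rewrite enormN.
  by have := cr _ mc; rewrite /eball/= subr0; lra.
have kapE : kap = \sum_i e' 0 i * m' 0 i + ev * ml.
  rewrite -dotE -last_coord; apply: eq_bigr => i _; by rewrite !mxE.
have ewm : `|\sum_i e' 0 i * (w - m') 0 i| <= enorm e' * (2 * r0).
  by rewrite (le_trans (cauchy_schwarz _ _))// ler_wpM2l// enorm_ge0.
have evA : `|ev| * `|A w - ml| <= 2 * delta * r0 + enorm e' * (2 * r0).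
  rewrite -normrM (_ : ev * _ = (\sum_i e' 0 i * w 0 i + ev * A w - kap) -
    \sum_i e' 0 i * (w - m') 0 i).
    by rewrite (le_trans (ler_normB _ _))// lerD.
  rewrite kapE (_ : \sum_i e' 0 i * (w - m') 0 i =
    \sum_i e' 0 i * w 0 i - \sum_i e' 0 i * m' 0 i); first by ring.
  by rewrite -sumrB; apply: eq_bigr => i _; rewrite !mxE; ring.
have Awm : 98 * tau * r0 <= `|A w - ml|.
  have h1 := lipA w m'; have h2 : tau * enorm (w - m') <= tau * (2 * r0).
    by rewrite ler_wpM2l// ltW.
  have := ler_distD (A w) (A m') ml; rewrite [X in _ <= X + _]distrC [`|A m' - ml|]distrC; lra.
(* Of the gap 100 tau r0, moving from m' to w along the graph costs 2 tau r0, and the horizontal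
   part of the slab condition costs 4 tau r0, because |e'| < 2 tau |ev|. *)
have ev1 : `|ev| * (94 * tau) <= 2 * delta.
  rewrite -(ler_pM2r r00).
  have h1 : `|ev| * (98 * tau * r0) <= `|ev| * `|A w - ml| by rewrite ler_wpM2l.
  have h2 : enorm e' * (2 * r0) <= (2 * (tau * `|ev|)) * (2 * r0).
    by rewrite ler_wpM2r ?mulr_ge0 ?(ltW r00)//; lra.
  lra.
have d1 : enorm e <= (2 + tau^-1) * delta.
  rewrite -(ler_pM2l tau0) mulrA mulrDr mulfV ?gt_eqF//.
  have : tau * enorm e <= tau * (enorm e' + `|ev|) by rewrite ler_wpM2l// ltW.
  have : 0 < tau * delta by rewrite mulr_gt0.
  have : tau * enorm e' <= tau * (2 * tau * `|ev|) by rewrite ler_wpM2l ?(ltW tau0)//; lra.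
  have : tau * (`|ev| * (94 * tau)) <= tau * (2 * delta) by rewrite ler_wpM2l// ltW.
  nra.
rewrite (_ : _ * (delta / enorm e) =
  K * r0 ^+ n * ((2 + tau^-1) * delta / enorm e)); last by field; rewrite !gt_eqF.
apply: ler_peMr; last by rewrite ler_pdivlMr// mul1r.
by apply: ltW; rewrite mulr_gt0// exprn_gt0.
Qed.

End transversality.

(** * Lower integrals and cluster points *)

Section finite_index_integral.
Local Open Scope ereal_scope.
Context d (T : measurableType d) (R : realType) (I : finType).
Variables (mu : {measure set T -> \bar R}) (D : set T) (mD : measurable D).
Variable idx : T -> I.
Hypothesis midx : forall i, measurable (idx @^-1` [set i]).

Lemma finite_index_sum (c : I -> R) x :
  (c (idx x))%:E = \sum_i (c i)%:E * (\1_(idx @^-1` [set i]) x)%:E.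
Proof.
rewrite (bigD1 (idx x))//= big1 ?adde0.
  by rewrite indicE mem_set// mule1.
move=> i ix; rewrite indicE memNset ?mule0// => xi; move: ix.
by rewrite -xi eqxx.
Qed.

Lemma measurable_finite_index (c : I -> R) :
  measurable_fun setT (fun x => (c (idx x))%:E).
Proof.
under eq_fun do rewrite finite_index_sum.
apply: emeasurable_sum => i; apply: emeasurable_funM; first exact: measurable_cst.
by apply/measurable_EFinP; exact: measurable_indic.
Qed.

Lemma integral_finite_index (c : I -> R) : (forall i, 0 <= c i)%R ->
  \int[mu]_(x in D) (c (idx x))%:E =
  \sum_i (c i)%:E * mu (idx @^-1` [set i] `&` D).
Proof.
move=> c0; under eq_integral do rewrite finite_index_sum.
rewrite ge0_integral_sum//=; last 2 first.
- move=> i; apply: emeasurable_funM; first exact: measurable_cst.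
  by apply/measurable_EFinP; exact: measurable_indic.
- by move=> i x _; rewrite mule_ge0// lee_fin.
apply: eq_bigr => i _; rewrite ge0_integralZl_EFin//.
- by rewrite integral_indic.
- by apply/measurable_EFinP; exact: measurable_indic.
Qed.

End finite_index_integral.

Section lower_integral.
Local Open Scope ereal_scope.
Context d (T : measurableType d) (R : realType).
Variable mu : {measure set T -> \bar R}.

(* No measurability is assumed: the integral of a nonnegative function is the
   supremum of the integrals of the simple functions below it. *)
Lemma le_lower_integral (D : set T) (f g : T -> \bar R) :
  (forall x, D x -> 0 <= f x) -> (forall x, D x -> f x <= g x) ->
  \int[mu]_(x in D) f x <= \int[mu]_(x in D) g x.
Proof.
move=> f0 fg; rewrite !ge0_integralE//; last first.
  by move=> x Dx; exact: le_trans (f0 x Dx) (fg x Dx).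
apply: ge_ereal_sup => _ [h /= hf <-]; apply: ereal_sup_ubound; exists h => //= x.
apply: le_trans (hf x) _; rewrite /patch; case: ifPn => // /set_mem; exact: fg.
Qed.

Lemma integral_mrestr (D : set T) (mD : measurable D) (f : T -> \bar R) :
  measurable_fun setT f -> (forall x, 0 <= f x) ->
  \int[mrestr mu mD]_x f x = \int[mu]_(x in D) f x.
Proof.
move=> mf f0; have mDC := measurableC mD.
rewrite (@ge0_negligible_integral _ _ _ (mrestr mu mD) setT (~` D))//=; last first.
  by rewrite /mrestr setICl measure0.
rewrite setTD setCK; apply: eq_measure_integral => A _ AD.
by change (mu (A `&` D) = mu A); rewrite setIidl.
Qed.

Import HBNNSimple.

(** The simple functions below f are measurable even if f is not, and [integral_mrestr] applies to
    each of them. This direction serves for slice capacities. *)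
Lemma le_integral_mrestr (D : set T) (mD : measurable D) (f : T -> \bar R) :
  (forall x, 0 <= f x) ->
  \int[mrestr mu mD]_x f x <= \int[mu]_(x in D) f x.
Proof.
move=> f0; rewrite ge0_integralTE//; apply: ge_ereal_sup => _ [h /= hf <-].
rewrite -integralT_nnsfun integral_mrestr//; last 2 first.
- exact/measurable_EFinP.
- by move=> x; rewrite lee_fin.
by apply: le_lower_integral => x _; rewrite ?lee_fin.
Qed.

End lower_integral.

Section cluster_weights.
Context {R : realType} {I : choiceType}.

(* Tychonoff's theorem for [0, 1]^I. *)
Lemma exists_cluster_weights (w_ : nat -> I -> R) :
  (forall k i, 0 <= w_ k i <= 1) ->
  exists w : I -> R, forall (s : seq I) (e : R) (k0 : nat), 0 < e ->
    exists2 k, (k0 <= k)%N & forall i, i \in s -> `|w i - w_ k i| < e.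
Proof.
move=> w01; pose A (i : I) := `[0 : R, 1]%classic.
have cA := @tychonoff I (fun=> R) A (fun i => @segment_compact R 0 1).
have := cA (w_ @ \oo) _; case.
  by exists 0%N => // k _ i; rewrite /A/= in_itv/=; exact: w01.
move=> w [_ clw]; exists w => s e k0 e0.
have ws : nbhs (w : ArrowAsProduct.prod__canonical__topology_structure_Topological (fun _ : I => R))
    [set f : I -> R | forall i, i \in s -> `|w i - f i| < e].
  elim: s => [|i s ih]; first by apply: filterS filterT.
  have wi : nbhs (w : ArrowAsProduct.prod__canonical__topology_structure_Topological (fun _ : I => R))
      (proj i @^-1` (ball (w i) e)).
    by apply: (@proj_continuous I (fun=> R) i w); exact: nbhsx_ballx.
  apply: filterS2 wi ih => f /= fi fs j; rewrite inE => /predU1P[->//|]; exact: fs.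
have [|f [[k k0k <-] fs]] := clw [set w_ k | k in [set k | (k0 <= k)%N]] _ _ ws.
  by exists k0 => // k k0k; exists k.
by exists k.
Qed.

End cluster_weights.

(** * Consistent masses on the binary tree, realized by Lebesgue measure *)

Section tree_intervals.
Context {R : realType}.
Variable w : seq bool -> R.
Hypothesis w0 : forall p, 0 <= w p.
Hypothesis w1 : w [::] = 1.
Hypothesis wS : forall p, w p = w (false :: p) + w (true :: p).

(* Nested subintervals [left_end p, left_end p + w p[ of [0, 1[, one for each
   node of the binary tree; a node lists its bits from the last to the first. *)
Fixpoint left_end (p : seq bool) : R :=
  if p is b :: p' then left_end p' + (if b then w (false :: p') else 0) else 0.

(** Bisection: for u in [0, 1[ this is the node of depth l whose interval holds u. Other u get a
    node too, without this meaning. *)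
Fixpoint branch (l : nat) (u : R) : seq bool :=
  if l is l'.+1 then
    (left_end (branch l' u) + w (false :: branch l' u) <= u) :: branch l' u
  else [::].

Lemma size_branch l u : size (branch l u) == l.
Proof. by elim: l => //= l ih. Qed.

Lemma branch_in l u : 0 <= u < 1 ->
  left_end (branch l u) <= u < left_end (branch l u) + w (branch l u).
Proof.
move=> u01; elim: l => [|l /=]; first by rewrite /= w1 add0r.
rewrite (wS (branch l u)) => /andP[h1 h2].
case: (leP (left_end (branch l u) + w (false :: branch l u)) u) => h3.
  by rewrite h3 -addrA h2.
by rewrite addr0 h1 h3.
Qed.

Lemma branch_eq p u : left_end p <= u < left_end p + w p -> branch (size p) u = p.
Proof.
elim: p => //= b p ih h.
have hp : left_end p <= u < left_end p + w p.
  by have := w0 (false :: p); have := w0 (true :: p); rewrite (wS p); case: b h; lra.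
rewrite (ih hp); congr cons; case: b h => /andP[h1 h2]; first by [].
by apply/negbTE; rewrite -ltNge; move: h2; rewrite addr0.
Qed.

Lemma left_end_ge0 p : 0 <= left_end p.
Proof. by elim: p => //= b p ih; case: b; rewrite ?addr0// addr_ge0. Qed.

Lemma right_end_le1 p : left_end p + w p <= 1.
Proof.
elim: p => /= [|b p ih]; first by rewrite w1 add0r.
by have := w0 (false :: p); have := w0 (true :: p); move: ih; rewrite (wS p); case: b; lra.
Qed.

Lemma measurable_branch_eq l p : measurable [set u : R | branch l u = p].
Proof.
elim: l p => [|l ih] p.
  have [->|p0] := eqVneq p [::].
    by rewrite (_ : [set u | _] = setT)//; apply/seteqP; split.
  rewrite (_ : [set u | _] = set0)// -subset0 => u /= pE; move: p0.
  by rewrite -pE eqxx.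
case: p => [|b p]; first by rewrite (_ : [set u | _] = set0)// -subset0.
set a := left_end p + w (false :: p).
rewrite (_ : [set u | _] = [set u | branch l u = p] `&`
    (if b then `[a, +oo[%classic else `]-oo, a[%classic)).
  by apply: measurableI => //; case: b.
apply/seteqP; split => u /=.
  move=> [ub up]; split => //; move: ub; rewrite up -/a; case: b => ub.
    by rewrite /= in_itv/= ub.
  by rewrite /= in_itv/= ltNge ub.
move=> [-> ]; rewrite -/a; case: b; rewrite /= in_itv/=; first by rewrite andbT => ->.
by rewrite ltNge => /negbTE ->.
Qed.

Definition unit_lebesgue : set (measurableTypeR R) -> \bar R :=
  mrestr lebesgue_measure (measurable_itv `[0 : R, 1[).

HB.instance Definition _ := Measure.on unit_lebesgue.

Let unit_lebesgue_setT : unit_lebesgue setT = 1%E.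
Proof.
by rewrite /unit_lebesgue /mrestr setTI/= lebesgue_measure_itv/= lte_fin ltr01 sube0.
Qed.

HB.instance Definition _ :=
  Measure_isProbability.Build _ _ _ unit_lebesgue unit_lebesgue_setT.

Lemma unit_lebesgue_branch p : unit_lebesgue [set u | branch (size p) u = p] = (w p)%:E.
Proof.
rewrite /unit_lebesgue /mrestr.
rewrite (_ : _ `&` _ = `[left_end p, (left_end p + w p)[%classic).
  rewrite lebesgue_measure_itv/= lte_fin; case: ltP => [_|h].
    by rewrite -EFinD addrAC subrr add0r.
  by apply/eqP; rewrite eqe eq_le w0/=; move: h; lra.
apply/seteqP; split => u /=; rewrite !in_itv/=.
  by move=> [up u01]; rewrite -up; exact: branch_in.
move=> h; split; first exact: branch_eq.
move: h => /andP[h1 h2]; rewrite (le_trans (left_end_ge0 p) h1)/=.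
exact: lt_le_trans h2 (right_end_le1 p).
Qed.

End tree_intervals.

(** * Riesz energies and capacities *)

Section riesz_kernel_truncation.
Context {R : realType} {m : nat} (t : R).
Hypothesis t0 : 0 < t.
Implicit Types x y : borelRV R m.

(** Shifting the distance makes the kernel finite on the diagonal and tolerant of small
    displacements of x and y. It increases to the Riesz kernel as e decreases to 0, so measurability
    and energy bounds pass to the limit. *)
Definition truncated_riesz (e : R) (x y : 'rV[R]_m) : R := (enorm (x - y) + e) `^ (- t).

Lemma truncated_riesz_ge0 e x y : 0 <= truncated_riesz e x y.
Proof. exact: powR_ge0. Qed.

Lemma le_powRN (a b : R) : 0 < a -> a <= b -> b `^ (- t) <= a `^ (- t).
Proof.
move=> a0 ab; rewrite !powRN lef_pV2 ?posrE ?powR_gt0//; last exact: lt_le_trans ab.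
apply: ge0_ler_powR => //; rewrite ?nnegrE; [exact: ltW|exact: ltW|].
exact: le_trans (ltW a0) ab.
Qed.

Lemma riesz_kernel_ge0 (x y : 'rV[R]_m) : (0 <= riesz_kernel t x y)%E.
Proof. by rewrite /riesz_kernel; case: ifPn => // _; rewrite lee_fin powR_ge0. Qed.

Lemma riesz_kernel_lb (x y : 'rV[R]_m) (a : R) : 0 < a -> enorm (x - y) <= a ->
  ((a `^ (- t))%:E <= riesz_kernel t x y)%E.
Proof.
move=> a0 xya; rewrite /riesz_kernel; case: ifPn => [_|xy]; first by rewrite leey.
rewrite lee_fin; apply: le_powRN => //.
rewrite lt_neqAle enorm_ge0 andbT eq_sym; apply: contra_neq xy => /enorm_eq0/eqP.
by rewrite subr_eq0 => /eqP.
Qed.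

Lemma truncated_riesz_cvg x y :
  ((truncated_riesz j.+1%:R^-1 x y)%:E @[j --> \oo] --> riesz_kernel t x y)%E.
Proof.
rewrite /riesz_kernel /truncated_riesz; have [->|xy] := eqVneq x y.
  apply/cvgeyPge => A; near=> j; rewrite subrr enorm0 add0r lee_fin powRN.
  have -> : (j.+1%:R^-1 `^ t)^-1 = j.+1%:R `^ t :> R.
    by rewrite -powRN -powR_inv1// -powRrM mulN1r opprK.
  pose N := Num.max A 1; apply: (@le_trans _ _ N); first by rewrite le_max lexx.
  have N0 : 0 <= N by rewrite le_max ler01 orbT.
  rewrite -[leLHS](_ : (N `^ t^-1) `^ t = N); last first.
    by rewrite -powRrM mulVf ?gt_eqF// powRr1.
  apply: ge0_ler_powR; rewrite ?nnegrE ?powR_ge0//; first exact: ltW.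
  near: j; exists (Num.truncn (N `^ t^-1)) => // j /= Nj.
  apply: (le_trans (ltW (truncnS_gt _))).
  by rewrite ler_nat.
have d0 : 0 < enorm (x - y).
  rewrite lt_neqAle enorm_ge0 andbT eq_sym; apply: contra_neq xy => /enorm_eq0/eqP.
  by rewrite subr_eq0 => /eqP.
apply: cvg_EFin; first by near=> j.
set d := enorm _ in d0 *.
have c : {for d, continuous (fun a : R => a `^ (- t))}.
  apply: differentiable_continuous; apply/derivable1_diffP.
  by apply: derivable_powR; rewrite in_itv/= d0.
apply: (@cvg_comp _ _ _ (fun j => d + j.+1%:R^-1 : R) (fun a : R => a `^ (- t)) _ (nbhs d)) c.
have : d + j.+1%:R^-1 @[j --> \oo] --> d + 0; last by rewrite addr0.
apply: cvgD; first exact: cvg_cst.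
exact: cvg_harmonic.
Unshelve. all: by end_near. Qed.

Lemma measurable_truncated_riesz e d (T : measurableType d) (f g : T -> borelRV R m) :
  measurable_fun setT f -> measurable_fun setT g ->
  measurable_fun setT (fun z => truncated_riesz e (f z) (g z)).
Proof.
move=> mf mg; apply: (measurableT_comp (measurable_powR (- t))).
by apply: measurable_funD => //; exact: measurable_enormB.
Qed.

Lemma measurable_riesz_kernel d (T : measurableType d) (f g : T -> borelRV R m) :
  measurable_fun setT f -> measurable_fun setT g ->
  measurable_fun setT (fun z => riesz_kernel t (f z) (g z)).
Proof.
move=> mf mg; apply: (emeasurable_fun_cvg
    (fun j z => (truncated_riesz j.+1%:R^-1 (f z) (g z))%:E)).
  by move=> j; apply/measurable_EFinP; exact: measurable_truncated_riesz.
by move=> z _; exact: truncated_riesz_cvg.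
Qed.

Lemma riesz_energyE (mu : probability (borelRV R m) R) :
  riesz_energy t mu = (\int[mu \x mu]_z riesz_kernel t z.1 z.2)%E.
Proof.
have mk : measurable_fun setT (fun z : borelRV R m * borelRV R m => riesz_kernel t z.1 z.2).
  exact: measurable_riesz_kernel.
by rewrite /riesz_energy fubini_tonelli1// => z; exact: riesz_kernel_ge0.
Qed.

Lemma riesz_energy_le (mu : probability (borelRV R m) R) (E : \bar R) :
  (forall e : R, (0 < e)%R -> \int[mu]_x \int[mu]_y (truncated_riesz e x y)%:E <= E)%E ->
  (riesz_energy t mu <= E)%E.
Proof.
move=> h; pose f j (z : borelRV R m * borelRV R m) := (truncated_riesz j.+1%:R^-1 z.1 z.2)%:E.
have mf j : measurable_fun setT (f j).
  by apply/measurable_EFinP; exact: measurable_truncated_riesz.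
have f0 j z : (0 <= f j z)%E by rewrite lee_fin powR_ge0.
rewrite riesz_energyE.
have -> : (\int[mu \x mu]_z riesz_kernel t z.1 z.2 =
    \int[mu \x mu]_z limn (f ^~ z))%E.
  by apply: eq_integral => z _; apply/esym/cvg_lim => //; exact: truncated_riesz_cvg.
rewrite monotone_convergence//; last first.
  move=> z _ i j ij; rewrite lee_fin; apply: le_powRN.
    by rewrite ltr_wpDl ?enorm_ge0.
  by rewrite lerD2l lef_pV2 ?posrE// ler_nat.
apply: lime_le.
  apply: ereal_nondecreasing_is_cvgn => i j ij; apply: ge0_le_integral => //.
  move=> z _; rewrite lee_fin; apply: le_powRN.
    by rewrite ltr_wpDl ?enorm_ge0.
  by rewrite lerD2l lef_pV2 ?posrE// ler_nat.
apply: nearW => j; rewrite fubini_tonelli1//.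
by apply: h.
Qed.

Lemma riesz_energy_ge0 (mu : probability (borelRV R m) R) :
  (0 <= riesz_energy t mu)%E.
Proof.
apply: integral_ge0 => x _; apply: integral_ge0 => y _; exact: riesz_kernel_ge0.
Qed.

Lemma Cap_le (K : set 'rV[R]_m) (x : \bar R) : (0 <= x)%E ->
  (forall mu : probability (borelRV R m) R, mu (~` K) = 0%E ->
    ((riesz_energy t mu)^-1 <= x)%E) -> (Cap t K <= x)%E.
Proof.
move=> x0 h; rewrite -[x]inveK /Cap lee_pV2 ?inE ?inve_ge0//; last first.
  by apply: le_ereal_inf_tmp => _ [mu _ <-]; exact: riesz_energy_ge0.
apply: le_ereal_inf_tmp => _ [mu /= muK <-]; rewrite -[leRHS]inveK.
by rewrite lee_pV2 ?inE ?inve_ge0 ?riesz_energy_ge0//; exact: h.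
Qed.

Lemma Cap_ge0 (K : set 'rV[R]_m) : (0 <= Cap t K)%E.
Proof.
rewrite inve_ge0; apply: le_ereal_inf_tmp => _ [mu _ <-]; exact: riesz_energy_ge0.
Qed.

Lemma Cap_ge (S : set 'rV[R]_m) (mu : probability (borelRV R m) R) (E : R) : 0 < E ->
  mu (~` S) = 0%E -> (riesz_energy t mu <= E%:E)%E -> (E^-1%:E <= Cap t S)%E.
Proof.
move=> E0 muS muE; have -> : E^-1%:E = (E%:E)^-1%E by rewrite inver gt_eqF.
rewrite /Cap lee_pV2 ?inE.
- by apply: le_trans muE; apply: ereal_inf_lbound; exists mu.
- by rewrite lee_fin ltW.
- by apply: le_ereal_inf_tmp => _ [nu _ <-]; exact: riesz_energy_ge0.
Qed.

End riesz_kernel_truncation.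

(** The displacements use up half of the shift e. The truncation e at limit points is thus dominated
    by the truncation e / 2 at cell representatives. *)
Lemma enorm_perturb (R : realType) m (x y x' y' : 'rV[R]_m) (e : R) :
  enorm (x - x') <= e / 4 -> enorm (y - y') <= e / 4 ->
  enorm (x' - y') + e / 2 <= enorm (x - y) + e.
Proof.
have := enorm_triangle x x' y'; have := enorm_triangle y x y'.
by rewrite [enorm (x' - x)]enormC; lra.
Qed.

(* A sequence of probability measures on K is recorded by the masses w_ k p of the
   cells of K with address p.  A cluster point w of these masses is realized as
   the image of Lebesgue measure on [0, 1[ under the map that sends the subinterval
   of index p into the closure of the cell p. *)
Section weak_limit.
Context {R : realType} {m : nat}.
Variables (K : set 'rV[R]_m) (b : nat -> 'rV[R]_m -> bool).
Hypothesis compactK : compact K.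

Fixpoint address (l : nat) (x : 'rV[R]_m) : seq bool :=
  if l is l'.+1 then b l' x :: address l' x else [::].

Lemma size_address l x : size (address l x) == l.
Proof. by elim: l => //= l ih. Qed.

Definition address_tuple l x : l.-tuple bool := Tuple (size_address l x).

Definition separated_at l (e : R) :=
  forall x y, K x -> K y -> address l x = address l y -> enorm (x - y) <= e.

Hypothesis separating : forall e : R, 0 < e -> exists l, separated_at l e.

Variables (w_ : nat -> seq bool -> R) (P : nat -> set 'rV[R]_m).
Hypothesis PK : forall k, P k `<=` K.
Hypothesis w_0 : forall k p, 0 <= w_ k p.
Hypothesis w_1 : forall k, w_ k [::] = 1.
Hypothesis w_S : forall k p, w_ k p = w_ k (false :: p) + w_ k (true :: p).
Hypothesis wP : forall k p, 0 < w_ k p -> exists2 x, P k x & address (size p) x = p.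

Let w_01 k p : 0 <= w_ k p <= 1.
Proof.
rewrite w_0/=; elim: p => [|a p]; first by rewrite w_1.
rewrite w_S; have := w_0 k (false :: p); have := w_0 k (true :: p).
by case: a; lra.
Qed.

Section cluster.
Variable w : seq bool -> R.
Hypothesis clw : forall (s : seq (seq bool)) (e : R) (k0 : nat), 0 < e ->
  exists2 k, (k0 <= k)%N & forall i, i \in s -> `|w i - w_ k i| < e.

Let w0 p : 0 <= w p.
Proof.
rewrite leNgt; apply/negP => wp.
have [|k _ /(_ p)] := clw [:: p] 0 (_ : 0 < - w p); first by rewrite oppr_gt0.
rewrite mem_head => /(_ isT); have := w_0 k p.
by rewrite ltr_norml; lra.
Qed.

Let w1 : w [::] = 1.
Proof.
apply/eqP; rewrite -subr_eq0 -normr_le0; apply/ler_addgt0Pr => e e0.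
have [k _ /(_ [::])] := clw [:: [::]] 0 e0.
by rewrite mem_head w_1 add0r => /(_ isT)/ltW.
Qed.

Let wS p : w p = w (false :: p) + w (true :: p).
Proof.
apply/eqP; rewrite -subr_eq0 -normr_le0; apply/ler_addgt0Pr => e e0; rewrite add0r.
have e30 : 0 < e / 3 by rewrite divr_gt0.
have [k _ h] := clw [:: p; false :: p; true :: p] 0 e30.
have := h p; have := h (false :: p); have := h (true :: p).
rewrite !inE !eqxx !orbT => /(_ isT) h1 /(_ isT) h2 /(_ isT) h3.
move: h1 h2 h3; rewrite (w_S k p) !ltr_norml ler_norml; lra.
Qed.

Let w_le1 p : w p <= 1.
Proof.
elim: p => [|a p]; first by rewrite w1.
by rewrite wS; have := w0 (false :: p); have := w0 (true :: p); case: a; lra.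
Qed.

Let w_pos p k0 : 0 < w p ->
  exists2 k, (k0 <= k)%N & exists2 x, P k x & address (size p) x = p.
Proof.
move=> wp; have [k k0k /(_ p)] := clw [:: p] k0 wp.
rewrite mem_head => /(_ isT) h; exists k => //; apply: wP.
by move: h; rewrite ltr_norml; lra.
Qed.

Let rep (p : seq bool) : 'rV[R]_m := xget 0 [set x | K x /\ address (size p) x = p].

Let rep_address x l : K x -> K (rep (address l x)) /\
  address l (rep (address l x)) = address l x.
Proof.
move=> Kx; rewrite /rep (eqP (size_address l x)).
by case: xgetP => [y _ //|/(_ x) h]; exfalso; exact: h.
Qed.

Let rep_branch l u : 0 <= u < 1 ->
  K (rep (branch w l u)) /\ address l (rep (branch w l u)) = branch w l u.
Proof.
move=> u01; have wp : 0 < w (branch w l u).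
  by have := branch_in w1 wS l u01; lra.
have [k _ [x Px]] := w_pos 0 wp.
rewrite (eqP (size_branch w l u)) => xu.
by have := rep_address l (PK Px); rewrite xu.
Qed.

Let branch_prefix l l' u x : (l <= l')%N ->
  address l' x = branch w l' u -> address l x = branch w l u.
Proof.
move=> /subnKC <-; elim: (l' - l)%N => [|j ih]; first by rewrite addn0.
by rewrite addnS /= => -[_ /ih].
Qed.

(** The cells along a branch are nested, so all later representatives stay within e of the one at
    depth l, and so does any of their cluster points. *)
Let rep_limit u : 0 <= u < 1 -> exists x : 'rV[R]_m, forall l (e : R),
  separated_at l e ->
  enorm (x - rep (branch w l u)) <= e.
Proof.
move=> u01; pose s l := rep (branch w l u).
have [|x [Kx clx]] := compactK (F := s @ \oo) _ _.
  by exists 0%N => // l _; exact: (rep_branch l u01).1.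
exists x => l e le; apply/ler_addgt0Pr => e' e'0.
have FA : (s @ \oo) [set s l' | l' in [set l' | (l <= l')%N]].
  by exists l => // l' ll'; exists l'.
have FB : nbhs x (eball x e') by apply/nbhs_eball; exists e'.
have [y [[l' /= ll' <-] xl']] := clx _ _ FA FB.
have [Kl al] := rep_branch l u01; have [Kl' al'] := rep_branch l' u01.
have := le _ _ Kl' Kl; rewrite al (branch_prefix ll' al') => /(_ erefl) h.
have := enorm_triangle (s l') x (s l).
move: xl'; rewrite /eball/= => h1 h2; rewrite enormC in h1.
by rewrite (le_trans h2)// addrC lerD// ltW.
Qed.

Let limit_point (u : measurableTypeR R) : borelRV R m :=
  xget 0 [set x : 'rV[R]_m | 0 <= u < 1 /\ forall l (e : R),
  separated_at l e ->
  enorm (x - rep (branch w l u)) <= e].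

Let limit_pointP u l (e : R) : 0 <= u < 1 ->
  separated_at l e ->
  enorm (limit_point u - rep (branch w l u) : 'rV[R]_m) <= e.
Proof.
move=> u01; rewrite /limit_point; case: xgetP => [x _ [_]|h]; first exact.
by have [x hx] := rep_limit u01; exfalso; apply: (h x).
Qed.

Let measurable_branch_mem l (Q : seq bool -> bool) :
  measurable [set u : measurableTypeR R | Q (branch w l u)].
Proof.
rewrite (_ : [set u | _] = \bigcup_(p in [set p : l.-tuple bool | Q p])
    [set u : R | branch w l u = p]).
  apply: fin_bigcup_measurable; first exact: finite_finset.
  by move=> p _; exact: measurable_branch_eq.
apply/seteqP; split => [u Qu|u [p Qp /= ->]//].
by exists (Tuple (size_branch w l u)).
Qed.

(** The preimage of an open U is, on [0, 1[, a union over i of conditions on the branch at depth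
    [l_ i], which takes finitely many values. The limit point is within 1/(i+1) of the
    representative: hence the radius 2/(i+1), and 3/(i+1) < e to keep that ball inside U. *)
Let measurable_limit_point : measurable_fun setT limit_point.
Proof.
have inv0 (i : nat) : 0 < i.+1%:R^-1 :> R by rewrite invr_gt0.
have [l_ sepl] := choice (fun i : nat => separating (inv0 i)).
have mE : @measurable _ (borelRV R m) = <<s @open 'rV[R]_m >> by [].
apply: (measurability _ mE) => _ [U oU <-]; rewrite setTI.
pose Q i p := `[< eball (rep p) (2 * i.+1%:R^-1) `<=` U >].
pose I01 : set (measurableTypeR R) := `[0 : R, 1[%classic.
have mI01 : measurable I01 by exact: measurable_itv.
rewrite (_ : limit_point @^-1` U =
    (I01 `&` \bigcup_i [set u | Q i (branch w (l_ i) u)]) `|`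
    (~` I01 `&` (if `[< U 0 >] then setT else set0))).
  apply: measurableU.
    apply: measurableI => //; apply: bigcupT_measurable => i.
    exact: measurable_branch_mem.
  by apply: measurableI => //; [exact: measurableC|case: ifP].
apply/seteqP; split => u.
  move=> Uu; have [u01|u01] := pselect (I01 u); last first.
    right; split => //; case: asboolP => // U0; exfalso; apply: U0; move: Uu.
    rewrite /= /limit_point; case: xgetP => // x _ [u01' _]; exfalso.
    by apply: u01; rewrite /I01/= in_itv.
  left; split => //.
  have /nbhs_eball[e e0 eU] : nbhs (limit_point u : 'rV[R]_m) U.
    by apply: open_nbhs_nbhs.
  pose i := Num.truncn (3 / e).
  have ie : 3 * i.+1%:R^-1 < e.
    by rewrite ltr_pdivrMr// mulrC -ltr_pdivrMr// truncnS_gt.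
  exists i => //; apply/asboolP => y; rewrite /eball/= => yi; apply: eU.
  rewrite /eball/= (le_lt_trans (enorm_triangle (rep (branch w (l_ i) u)) _ _))//.
  have := limit_pointP u01 (sepl i); rewrite enormC => h.
  by apply: le_lt_trans ie; move: h yi; move: (i.+1%:R^-1) => z; lra.
move=> [[u01 [i _ /asboolP Qi]]|[u01]].
  apply: Qi; rewrite /eball/= (le_lt_trans (limit_pointP u01 (sepl i)))//.
  by have := inv0 i; move: (i.+1%:R^-1) => z; lra.
case: asboolP => // U0 _; rewrite /= /limit_point; case: xgetP => // x _ [u01' _].
by exfalso; apply: u01; rewrite /I01/= in_itv.
Qed.

HB.instance Definition _ := isMeasurableFun.Build _ _ _ _ limit_point
  measurable_limit_point.

Definition limit_measure : probability (borelRV R m) R :=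
  distribution (@unit_lebesgue R) limit_point.

(** A limit point is close to a small cell of positive limiting mass, which [P k] meets for
    arbitrarily large k. *)
Lemma limit_measure_support (S : set 'rV[R]_m) :
  (forall x, (forall (e : R) k0, 0 < e -> exists2 k, (k0 <= k)%N &
     exists2 y, P k y & enorm (x - y) <= e) -> S x) ->
  limit_measure (~` S) = 0%E.
Proof.
move=> LS; rewrite /limit_measure /distribution /= /pushforward /unit_lebesgue /mrestr.
rewrite (_ : _ `&` _ = set0) ?measure0// -subset0 => u [] /= uS.
rewrite in_itv/= => u01; apply: uS; apply: LS => e k0 e0.
have e20 : 0 < e / 2 by rewrite divr_gt0.
have [l sepl] := separating e20.
have wp : 0 < w (branch w l u) by have := branch_in w1 wS l u01; lra.
have [k k0k [x Px]] := w_pos k0 wp; rewrite (eqP (size_branch w l u)) => xu.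
exists k => //; exists x => //.
have [Kr ar] := rep_branch l u01.
have := enorm_triangle (rep (branch w l u)) (limit_point u : 'rV[R]_m) x.
have := sepl _ _ Kr (PK Px); rewrite ar xu => /(_ erefl).
have := limit_pointP u01 sepl; lra.
Qed.

(** At a fixed depth the energy is a quadratic form in finitely many weights of [0, 1], and changing
    each weight by less than d changes a product by at most 2 d. *)
Let w_sum l (kap : l.-tuple bool -> l.-tuple bool -> R) (E : R) :
  (forall p q, 0 <= kap p q) ->
  (forall k, \sum_p \sum_q kap p q * w_ k p * w_ k q <= E) ->
  \sum_p \sum_q kap p q * w p * w q <= E.
Proof.
move=> kap0 kapE; apply/ler_addgt0Pr => e e0.
pose C := \sum_p \sum_q kap p q.
have C0 : 0 <= C by apply: sumr_ge0 => p _; apply: sumr_ge0.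
have C20 : 0 < 2 * C + 1 by rewrite ltr_wpDl// mulr_ge0.
have d0 : 0 < e / (2 * C + 1) by rewrite divr_gt0.
have [k _ wk] := clw [seq val p | p : l.-tuple bool] 0 d0.
have {}wk (p : l.-tuple bool) : `|w p - w_ k p| < e / (2 * C + 1).
  by apply: wk; apply: map_f; rewrite mem_enum.
set d := e / _ in d0 wk.
apply: (@le_trans _ _ (\sum_p \sum_q (kap p q * w_ k p * w_ k q + kap p q * (2 * d)))).
  apply: ler_sum => p _; apply: ler_sum => q _.
  rewrite -!mulrA -mulrDr ler_wpM2l//.
  have := wk p; have := wk q; have := w_le1 q; have := w0 q.
  have /andP[] := w_01 k p.
  rewrite !ltr_norml => h1 h2 h3 h4 /andP[h5 h6] /andP[h7 h8].
  have : (w p - w_ k p) * w q <= d * w q by rewrite ler_wpM2r// ltW.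
  have : w_ k p * (w q - w_ k q) <= w_ k p * d by rewrite ler_wpM2l// ltW.
  have : d * w q <= d by rewrite ler_piMr// ltW.
  have : w_ k p * d <= d by rewrite ler_piMl// ltW.
  by move: (w p) (w q) (w_ k p) (w_ k q) => a1 a2 a3 a4; nra.
under eq_bigr do rewrite big_split/=.
rewrite big_split/= lerD//.
have -> : \sum_(p : l.-tuple bool) \sum_q kap p q * (2 * d) = C * (2 * d).
  by rewrite /C mulr_suml; apply: eq_bigr => p _; rewrite mulr_suml.
rewrite /d mulrA mulrA ler_pdivrMr// -/d mulrDr mulr1.
have := mulr_ge0 C0 (ltW e0); lra.
Qed.

Lemma limit_measure_energy (t E : R) : 0 < t ->
  (forall l (kap : l.-tuple bool -> l.-tuple bool -> R), (forall p q, 0 <= kap p q) ->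
    (forall x y, K x -> K y ->
      ((kap (address_tuple l x) (address_tuple l y))%:E <= riesz_kernel t x y)%E) ->
    forall k, \sum_p \sum_q kap p q * w_ k p * w_ k q <= E) ->
  (riesz_energy t limit_measure <= E%:E)%E.
Proof.
move=> t0 kapE; apply: riesz_energy_le => // e e0.
have e40 : 0 < e / 4 by rewrite divr_gt0.
have e20 : 0 < e / 2 by rewrite divr_gt0.
have [l sepl] := separating e40.
(* The shift e / 2 serves twice. As cells have diameter at most e / 4, it puts the step kernel below
   the Riesz kernel on K, and above the truncation e at limit points. *)
pose kap (p q : l.-tuple bool) := truncated_riesz t (e / 2) (rep p) (rep q).
have kap0 p q : 0 <= kap p q by exact: truncated_riesz_ge0.
have kapk x y : K x -> K y ->
    ((kap (address_tuple l x) (address_tuple l y))%:E <= riesz_kernel t x y)%E.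
  move=> Kx Ky; apply: riesz_kernel_lb => //; first by rewrite ltr_wpDl ?enorm_ge0.
  have [Krx arx] := rep_address l Kx; have [Kry ary] := rep_address l Ky.
  have := sepl _ _ Kx Krx (esym arx); have := sepl _ _ Kry Ky ary => /=.
  have := enorm_triangle (rep (address l x)) x y.
  have := enorm_triangle (rep (address l y)) (rep (address l x)) y; lra.
have := w_sum kap0 (kapE l kap kap0 kapk); rewrite -lee_fin; apply: le_trans.
pose br (u : measurableTypeR R) : l.-tuple bool := Tuple (size_branch w l u).
have mbr (p : l.-tuple bool) : measurable (br @^-1` [set p]).
  rewrite (_ : _ @^-1` _ = [set u | branch w l u = p]).
    exact: measurable_branch_eq.
  by apply/seteqP; split => u /=; [move=> <-|move=> up; exact: val_inj].
have Pbr (p : l.-tuple bool) : unit_lebesgue (br @^-1` [set p]) = (w p)%:E.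
  rewrite -(unit_lebesgue_branch w0 w1 wS) size_tuple; congr unit_lebesgue.
  by apply/seteqP; split => u /=; [move=> <-|move=> up; exact: val_inj].
have mtr (x : borelRV R m) : measurable_fun setT (fun y : borelRV R m =>
    (truncated_riesz t e x y)%:E).
  by apply/measurable_EFinP; apply: measurable_truncated_riesz.
have mF : measurable_fun setT (fun x : borelRV R m =>
    \int[limit_measure]_y (truncated_riesz t e x y)%:E)%E.
  apply: (measurable_fun_fubini_tonelli_F (m2 := limit_measure)
    (fun z : borelRV R m * borelRV R m => (truncated_riesz t e z.1 z.2)%:E)).
    by apply/measurable_EFinP; exact: measurable_truncated_riesz.
  by move=> z; rewrite lee_fin truncated_riesz_ge0.
have le_unit (f g : measurableTypeR R -> \bar R) :
    measurable_fun setT f -> measurable_fun setT g ->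
    (forall u, 0 <= f u)%E -> (forall u, 0 <= g u)%E ->
    (forall u, (0 <= u < 1)%R -> f u <= g u)%E ->
    (\int[@unit_lebesgue R]_u f u <= \int[@unit_lebesgue R]_u g u)%E.
  move=> mf mg f0 g0 fg; rewrite /unit_lebesgue !integral_mrestr//.
  by apply: le_lower_integral => // u; rewrite /= in_itv/=; exact: fg.
rewrite /limit_measure ge0_integral_distribution//; last first.
  by move=> x; apply: integral_ge0 => y _; rewrite lee_fin truncated_riesz_ge0.
pose c p := \sum_q kap p q * w q.
have c0 p : 0 <= c p by apply: sumr_ge0 => q _; rewrite mulr_ge0.
have inner u : 0 <= u < 1 ->
    (\int[limit_measure]_y (truncated_riesz t e (limit_point u) y)%:E <=
    (c (br u))%:E)%E.
  move=> u01; rewrite /limit_measure ge0_integral_distribution//; last first.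
    by move=> y; rewrite lee_fin truncated_riesz_ge0.
  rewrite [leRHS](_ : _ = \int[@unit_lebesgue R]_v (kap (br u) (br v))%:E)%E; last first.
    rewrite integral_finite_index// /c -sumEFin; apply: eq_bigr => q _.
    by rewrite setIT [X in (_ * X)%E]Pbr.
  apply: le_unit.
  - exact: (measurableT_comp (mtr _)).
  - exact: (measurable_finite_index mbr).
  - by move=> v; rewrite lee_fin truncated_riesz_ge0.
  - by move=> v; rewrite lee_fin.
  move=> v v01; rewrite /= lee_fin; apply: le_powRN => //.
    by rewrite ltr_wpDl ?enorm_ge0.
  exact: enorm_perturb (limit_pointP u01 sepl) (limit_pointP v01 sepl).
apply: (@le_trans _ _ (\int[@unit_lebesgue R]_u (c (br u))%:E)%E).
  apply: le_unit.
  - exact: (measurableT_comp mF).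
  - exact: (measurable_finite_index mbr).
  - by move=> u; apply: integral_ge0 => y _; rewrite lee_fin truncated_riesz_ge0.
  - by move=> u; rewrite lee_fin.
  - exact: inner.
rewrite integral_finite_index//.
rewrite le_eqVlt; apply/orP; left; apply/eqP.
rewrite -sumEFin; apply: eq_bigr => p _.
rewrite setIT [X in (_ * X)%E]Pbr -EFinM /c mulr_suml; congr EFin.
by apply: eq_bigr => q _; rewrite mulrAC.
Qed.

End cluster.

(* The hypothesis on E bounds the energies of the approximating measures through
   minorants kap of the kernel that are constant on products of cells. *)
Lemma exists_limit_measure : exists mu : probability (borelRV R m) R,
  (forall S : set 'rV[R]_m,
    (forall x, (forall (e : R) k0, 0 < e -> exists2 k, (k0 <= k)%N &
      exists2 y, P k y & enorm (x - y) <= e) -> S x) -> mu (~` S) = 0%E) /\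
  forall t E : R, 0 < t ->
  (forall l (kap : l.-tuple bool -> l.-tuple bool -> R), (forall p q, 0 <= kap p q) ->
    (forall x y, K x -> K y ->
      ((kap (address_tuple l x) (address_tuple l y))%:E <= riesz_kernel t x y)%E) ->
    forall k, \sum_p \sum_q kap p q * w_ k p * w_ k q <= E) ->
  (riesz_energy t mu <= E%:E)%E.
Proof.
have [w clw] := exists_cluster_weights w_01.
exists (limit_measure clw); split; first exact: limit_measure_support.
exact: limit_measure_energy.
Qed.

End weak_limit.

(** * Capacity bounds from sequences of restricted measures *)

Section capacity_limit.
Context {R : realType} {m : nat}.

(** The bits ask for membership in the balls of finite 1/(i+1)-nets of K, numbered by [pickle].
    Points of K that agree on the bits of net i share a ball, hence are within 2/(i+1). *)
Lemma exists_separating_bits (K : set 'rV[R]_m) : compact K ->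
  exists b : nat -> 'rV[R]_m -> bool,
    (forall l, measurable ([set x | b l x] : set (borelRV R m))) /\
    forall e : R, 0 < e -> exists l, separated_at K b l e.
Proof.
move=> cK.
have cover i : exists s : seq 'rV[R]_m, forall x, K x ->
    exists2 c, c \in s & eball c i.+1%:R^-1 x.
  move: cK; rewrite compact_cover => /(_ _ setT (fun c => eball c i.+1%:R^-1)).
  move=> [c _|x Kx|D _ KD]; first exact: open_eball.
    by exists x => //; rewrite /eball/= subrr enorm0 invr_gt0.
  by exists (finmap.enum_fset D) => x /KD[c /= cD xc]; exists c.
have [s sP] := choice cover.
pose b l x := if unpickle l is Some (i, j)
  then `[< eball (nth 0 (s i) j) i.+1%:R^-1 x >] else false.
exists b; split.
  move=> l; rewrite /b; case: unpickle => [[i j]|]; last first.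
    by rewrite (_ : [set _ | _] = set0)// -subset0.
  rewrite (_ : [set _ | _] = eball (nth 0 (s i) j) i.+1%:R^-1).
    by apply: sub_sigma_algebra; exact: open_eball.
  by apply/seteqP; split => x /= /asboolP.
have adr l l' x y : (l' < l)%N -> address b l x = address b l y -> b l' x = b l' y.
  elim: l => // l ih; rewrite ltnS leq_eqVlt => /predU1P[->|l'l] /= [bl al] //.
  exact: ih.
move=> e e0; pose i := Num.truncn (2 / e).
have ie : 2 * i.+1%:R^-1 < e.
  by rewrite ltr_pdivrMr// mulrC -ltr_pdivrMr// truncnS_gt.
exists (\max_(j < size (s i)) pickle (i, val j)).+1 => x y Kx Ky axy.
have [c cs xc] := sP i x Kx.
pose j := index c (s i); have js : (j < size (s i))%N by rewrite index_mem.
have jl : (pickle (i, j) < (\max_(j < size (s i)) pickle (i, val j)).+1)%N.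
  by rewrite ltnS (leq_bigmax (Ordinal js)).
have := adr _ _ _ _ jl axy; rewrite /b pickleK nth_index//.
rewrite (asboolT xc) => /esym/asboolP yc.
move: xc yc; rewrite /eball/= => xc yc.
have := enorm_triangle c x y; rewrite [enorm (c - y)]enormC.
move: ie xc yc; move: (i.+1%:R^-1) => z; lra.
Qed.

(* The normalized restrictions of mu to A k have energy at most 1 / v, and their
   weak cluster points are carried by S. *)
Lemma Cap_limit_ge (t v : R) (K S : set 'rV[R]_m) (mu : probability (borelRV R m) R)
    (A : nat -> set (borelRV R m)) :
  0 < t -> 0 < v -> compact K ->
  (forall k, measurable (A k)) -> (forall k, A k `<=` K) ->
  (forall k, 0 < mu (A k))%E ->
  (forall k, v%:E * \int[mu]_(x in A k) \int[mu]_(y in A k) riesz_kernel t x y <=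
    mu (A k) ^+ 2)%E ->
  (forall x : 'rV[R]_m, (forall (e : R) k0, 0 < e -> exists2 k, (k0 <= k)%N &
      exists2 y : 'rV[R]_m, A k y & enorm (x - y) <= e) -> S x) ->
  (v%:E <= Cap t S)%E.
Proof.
move=> t0 v0 cK mA AK muA vA AS.
have [b [mb sep]] := exists_separating_bits cK.
have mad l p : measurable ([set x | address b l x = p] : set (borelRV R m)).
  elim: l p => [|l ih] p.
    have [->|p0] := eqVneq p [::].
      by rewrite (_ : [set u | _] = setT)//; apply/seteqP; split.
    rewrite (_ : [set u | _] = set0)// -subset0 => u /= pE; move: p0.
    by rewrite -pE eqxx.
  case: p => [|a p]; first by rewrite (_ : [set u | _] = set0)// -subset0.
  rewrite (_ : [set u | _] = [set x | address b l x = p] `&`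
      (if a then [set x | b l x] else ~` [set x | b l x])).
    by apply: measurableI => //; case: a => //; exact: measurableC.
  apply/seteqP; split => u /=.
    by move=> [<- <-]; split => //; case: ifPn => // /negP.
  by move=> [->]; case: a => [->//|/negP/negbTE ->].
pose N k := fine (mu (A k)).
have NE k : mu (A k) = (N k)%:E by rewrite fineK// fin_num_measure.
have N0 k : 0 < N k by rewrite -lte_fin -NE.
pose cell k p := A k `&` [set x | address b (size p) x = p].
have mcell k p : measurable (cell k p) by exact: measurableI.
pose w_ k p := fine (mu (cell k p)) / N k.
have cellE k p : mu (cell k p) = (w_ k p * N k)%:E.
  by rewrite /w_ divfK ?gt_eqF// fineK// fin_num_measure.
have w_0 k p : 0 <= w_ k p by rewrite divr_ge0 ?fine_ge0 ?(ltW (N0 k)).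
have w_1 k : w_ k [::] = 1.
  rewrite /w_ /cell (_ : [set x | _] = setT).
    by rewrite setIT divff// -/(N k) gt_eqF.
  by apply/seteqP; split.
have w_S k p : w_ k p = w_ k (false :: p) + w_ k (true :: p).
  apply: (mulIf (lt0r_neq0 (N0 k))); apply/EFin_inj.
  rewrite mulrDl EFinD -!cellE -measureU//; first last.
    by rewrite -subset0 => x [[_ /= [h1 _]] [_ /= [h2 _]]]; move: h1; rewrite h2.
  congr (mu _); apply/seteqP; split => x.
    move=> [Ax /= xp]; case bx : (b (size p) x); [right|left]; split => //=;
    by rewrite bx xp.
  by move=> [[Ax /= [_ xp]]|[Ax /= [_ xp]]].
have wP k p : 0 < w_ k p -> exists2 x, A k x & address b (size p) x = p.
  move=> wp; have /set0P[x [Ax xp]] : cell k p != set0; last by exists x.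
  apply/eqP => c0; move: wp; rewrite /w_ c0 measure0/= mul0r ltxx//.
have [nu [nuS nuE]] := exists_limit_measure cK sep AK w_0 w_1 w_S wP.
rewrite -[v]invrK; apply: (@Cap_ge _ _ t S nu); rewrite ?invr_gt0//.
  exact: nuS.
apply: nuE => // l kap kap0 kapk k.
rewrite -(ler_pM2l v0) mulfV ?gt_eqF//.
have N20 : 0 < N k ^+ 2 by rewrite exprn_gt0.
rewrite -(ler_pM2r N20) mul1r -lee_fin.
have -> : ((N k ^+ 2)%:E = mu (A k) ^+ 2)%E by rewrite NE EFin_expe.
apply: le_trans (vA k).
rewrite -mulrA EFinM; apply: lee_wpmul2l; first by rewrite lee_fin ltW.
have mad' p : measurable ((address_tuple b l : borelRV R m -> _) @^-1` [set p]).
  rewrite (_ : _ @^-1` _ = [set x | address b l x = p])//.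
  by apply/seteqP; split => u /=; [move=> <-|move=> up; exact: val_inj].
have cell_tuple (p : l.-tuple bool) :
    address_tuple b l @^-1` [set p] `&` A k = cell k p.
  rewrite setIC /cell size_tuple; congr (_ `&` _).
  by apply/seteqP; split => u /=; [move=> <-|move=> up; exact: val_inj].
pose c p := \sum_q kap p q * (w_ k q * N k).
have c0 p : 0 <= c p.
  by apply: sumr_ge0 => q _; apply: mulr_ge0 => //; apply: mulr_ge0 => //; exact: ltW.
have -> : (\sum_p \sum_q kap p q * w_ k p * w_ k q) * N k ^+ 2 =
    \sum_p c p * (w_ k p * N k).
  rewrite mulr_suml; apply: eq_bigr => p _; rewrite /c !mulr_suml.
  by apply: eq_bigr => q _; ring.
have -> : (\sum_p c p * (w_ k p * N k))%:E =
    (\int[mu]_(x in A k) (c (address_tuple b l x))%:E)%E.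
  rewrite integral_finite_index// -sumEFin; apply: eq_bigr => p _.
  by rewrite EFinM -cellE cell_tuple.
apply: le_lower_integral => x Ax; first by rewrite lee_fin.
have -> : (c (address_tuple b l x))%:E =
    (\int[mu]_(y in A k) (kap (address_tuple b l x) (address_tuple b l y))%:E)%E.
  rewrite integral_finite_index// /c -sumEFin; apply: eq_bigr => q _.
  by rewrite EFinM -cellE cell_tuple.
apply: le_lower_integral => y Ay; first by rewrite lee_fin.
by apply: kapk; exact: (AK k).
Qed.

End capacity_limit.

(** * Slicing *)

Section radial_slices.
Context d1 d2 (X : measurableType d1) (Z : measurableType d2) (R : realType).
Local Notation Omega := (Z * measurableTypeR R)%type.
Variables (mu : probability X R) (sg : {finite_measure set Z -> \bar R}).
Variables (rad : Z * X -> R) (kt ks : X * X -> \bar R).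
Variables (K : set X) (G : set Z) (kap R0 B : R).
Hypothesis mrad : measurable_fun setT rad.
Hypothesis mkt : measurable_fun setT kt.
Hypothesis mks : measurable_fun setT ks.
Hypothesis kt0 : forall p, (0 <= kt p)%E.
Hypothesis ks0 : forall p, (0 <= ks p)%E.
Hypothesis mK : measurable K.
Hypothesis mG : measurable G.
Hypothesis muK : mu (~` K) = 0%E.
Hypothesis kap0 : 0 < kap.
Hypothesis kapK : forall x y, K x -> K y -> (kap%:E <= kt (x, y))%E.
Hypothesis radKG : forall z x, G z -> K x -> rad (z, x) <= R0.
Hypothesis rad_ge0 : forall p, 0 <= rad p.
Hypothesis B0 : 0 < B.
Hypothesis transversal : forall x y (d : R), K x -> K y -> 0 < d ->
  (kt (x, y) * sg [set z | G z /\ (`|rad (z, x) - rad (z, y)| <= d)%R] <=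
    (B * d)%:E * ks (x, y))%E.

Let lam : {sigma_finite_measure set (measurableTypeR R) -> \bar R} := @lebesgue_measure R.

Let lam_itv (a d : R) : 0 < d -> lam `]a, (a + d)]%classic = d%:E.
Proof.
move=> d0; rewrite /lam /= lebesgue_measure_itv/= lte_fin ltrDl d0 -EFinD.
by rewrite addrAC subrr add0r.
Qed.

(* Products of sigma-finite measures have no canonical sigma-finite instance. *)
Definition center_radius_measure : set Omega -> \bar R := (sg \x lam)%E.

HB.instance Definition _ := Measure.on center_radius_measure.

Let center_radius_sigma_finite : sigma_finite setT center_radius_measure.
Proof.
exists (fun k => setT `*` `[- k%:R, k%:R]%classic).
  apply/seteqP; split => // -[z r] _; exists (Num.truncn `|r|).+1 => //.
  split => //=; rewrite in_itv/= -ler_norml; exact/ltW/truncnS_gt.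
move=> k; split; first exact: measurableX.
rewrite /center_radius_measure product_measure1E// lte_mul_pinfty//.
  by rewrite ge0_fin_numE// ltey_eq fin_num_measure.
rewrite /lam /= lebesgue_measure_itv/=; case: ifP => // _.
by rewrite -EFinD ltry.
Qed.

HB.instance Definition _ := Measure_isSigmaFinite.Build _ _ _
  center_radius_measure center_radius_sigma_finite.

Let nu : {sigma_finite_measure set Omega -> \bar R} := center_radius_measure.
Let mumu : probability (X * X)%type R := (mu \x mu)%E.

(** For fixed z in G and x in K the admissible r fill []rad, rad + d]], of length exactly d. The
    strict lower end makes r positive. *)
Definition slab_incidence (d : R) : set (Omega * X) :=
  [set w | [/\ G w.1.1, K w.2, rad (w.1.1, w.2) < w.1.2 &
    w.1.2 <= rad (w.1.1, w.2) + d]].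

Local Notation W := slab_incidence.

Definition slab d (w : Omega) : set X := xsection (W d) w.

Lemma measurable_incidence d : measurable (W d).
Proof.
have m11 : measurable_fun setT (fun w : Omega * X => w.1.1).
  exact: (measurableT_comp measurable_fst measurable_fst).
have m12 : measurable_fun setT (fun w : Omega * X => w.1.2).
  exact: (measurableT_comp measurable_snd measurable_fst).
have me : measurable_fun setT (fun w : Omega * X => rad (w.1.1, w.2)).
  apply: (measurableT_comp mrad); apply: measurable_fun_pair => //.
rewrite (_ : W d = ((fun w => w.1.1) @^-1` G `&` snd @^-1` K) `&`
    ((fun w : Omega * X => rad (w.1.1, w.2) < w.1.2) @^-1` [set true] `&`
    (fun w : Omega * X => w.1.2 <= rad (w.1.1, w.2) + d) @^-1` [set true])).
  apply: measurableI; apply: measurableI.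
  - by rewrite -[X in measurable X]setTI; exact: m11.
  - by rewrite -[X in measurable X]setTI; exact: measurable_snd.
  - by rewrite -[X in measurable X]setTI; exact: measurable_fun_ltr.
  - rewrite -[X in measurable X]setTI; apply: measurable_fun_ler => //.
    exact: measurable_funD.
by apply/seteqP; split => w /=; [case=> *; do !split|case=> -[? ?] []; split].
Qed.

Lemma measurable_slab d w : measurable (slab d w).
Proof. exact: measurable_xsection (measurable_incidence d). Qed.

Let mass d w := mu (slab d w).

(** Indicators replace the moving domain, so the energy of a shell is an integral over a fixed
    space: measurable in w and open to Tonelli. *)
Let pair_density d (p : Omega * (X * X)) : \bar R :=
  ((\1_(W d) (p.1, p.2.1) * \1_(W d) (p.1, p.2.2))%:E * kt p.2)%E.

Let energy d w := (\int[mumu]_q pair_density d (w, q))%E.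

Let pair_density_ge0 d p : (0 <= pair_density d p)%E.
Proof. by rewrite mule_ge0// lee_fin mulr_ge0. Qed.

Let energy_ge0 d w : (0 <= energy d w)%E.
Proof. exact: integral_ge0. Qed.

Let measurable_mass d : measurable_fun setT (mass d).
Proof. exact: measurable_fun_xsection (measurable_incidence d). Qed.

Let measurable_pair_density d : measurable_fun setT (pair_density d).
Proof.
have m1 : measurable_fun setT (fun p : Omega * (X * X) => (p.1, p.2.1)).
  apply: measurable_fun_pair; first exact: measurable_fst.
  exact: (measurableT_comp measurable_fst measurable_snd).
have m2 : measurable_fun setT (fun p : Omega * (X * X) => (p.1, p.2.2)).
  apply: measurable_fun_pair; first exact: measurable_fst.
  exact: (measurableT_comp measurable_snd measurable_snd).
have mW : measurable_fun setT (\1_(W d) : Omega * X -> R).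
  by apply: measurable_indic; exact: measurable_incidence.
apply: emeasurable_funM.
  apply/measurable_EFinP; apply: measurable_funM.
    exact: (measurableT_comp mW m1).
  exact: (measurableT_comp mW m2).
exact: (measurableT_comp mkt measurable_snd).
Qed.

Let measurable_energy d : measurable_fun setT (energy d).
Proof.
exact: (measurable_fun_fubini_tonelli_F (m2 := mumu) _ (measurable_pair_density d)
  (pair_density_ge0 d)).
Qed.

Let energyE d w : energy d w =
  (\int[mu]_(x in slab d w) \int[mu]_(y in slab d w) kt (x, y))%E.
Proof.
have mf : measurable_fun setT (fun q => pair_density d (w, q)).
  exact: (measurable_fun_pair2 _ (measurable_pair_density d)).
have -> : energy d w = (\int[mu]_x \int[mu]_y pair_density d (w, (x, y)))%E.
  exact: (fubini_tonelli1 _ mf (fun q => pair_density_ge0 d (w, q))).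
rewrite [RHS]integral_mkcond; apply: eq_integral => x _.
rewrite /pair_density /= patchE.
have inW y : \1_(W d) (w, y) = \1_(slab d w) y :> R.
  by rewrite !indicE mem_xsection.
case: ifPn => xA.
  rewrite [RHS]integral_mkcond; apply: eq_integral => y _.
  rewrite !inW !indicE xA mul1r patchE; case: ifPn => _; first by rewrite mul1e.
  by rewrite mul0e.
by apply: integral0_eq => y _; rewrite !inW !indicE (negbTE xA) mul0r mul0e.
Qed.

Let energy_lb d w : (kap%:E * mass d w ^+ 2 <= energy d w)%E.
Proof.
rewrite energyE.
have inK x : slab d w x -> K x by rewrite /slab xsectionE => -[].
have mS := measurable_slab d w.
apply: (@le_trans _ _ (\int[mu]_(x in slab d w)
    \int[mu]_(y in slab d w) (kap%:E))%E).
  under eq_integral do rewrite (integral_cst mu mS).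
  by rewrite (integral_cst mu mS) expe2 muleA.
apply: le_lower_integral => x xA; first by apply: integral_ge0 => y _; rewrite lee_fin ltW.
apply: le_lower_integral => y yA; first by rewrite lee_fin ltW.
by apply: kapK; exact: inK.
Qed.

Let integral_mass d : 0 < d -> (d%:E * sg G <= \int[nu]_w mass d w)%E.
Proof.
move=> d0; have mW := measurable_incidence d.
have := indic_fubini_tonelli nu mu mW; rewrite indic_fubini_tonelli_FE// => ->.
rewrite indic_fubini_tonelli_GE//.
have mY : measurable_fun setT (nu \o ysection (W d)).
  exact: measurable_fun_ysection.
rewrite (@ge0_negligible_integral _ _ _ mu setT (~` K))//=; last exact: measurableC.
rewrite setTD setCK.
have muK1 : mu K = 1%E by rewrite -[K]setCK probability_setC ?muK ?sube0//; exact: measurableC.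
apply: (@le_trans _ _ (\int[mu]_(x in K) (cst (d%:E * sg G) x))%E).
  by rewrite (integral_cst mu mK) [X in (_ <= _ * X)%E]muK1 mule1.
apply: le_lower_integral => x Kx; first by rewrite mule_ge0// lee_fin ltW.
rewrite /= /nu /= /center_radius_measure /product_measure1.
apply: (@le_trans _ _ (\int[sg]_z (d%:E * (\1_G z)%:E))%E).
  rewrite ge0_integralZl_EFin//; last first.
  - exact: ltW.
  - by apply/measurable_EFinP; exact: measurable_indic.
  by rewrite integral_indic// setIT.
apply: le_lower_integral => z _; first by rewrite mule_ge0// lee_fin ltW.
rewrite indicE; case: (boolP (z \in G)) => [zG|_]; last by rewrite mule0.
rewrite mule1 /=.
have -> : xsection (ysection (W d) x) z = `](rad (z, x)), (rad (z, x) + d)]%classic.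
  rewrite xsectionE ysectionE; apply/seteqP; split => r /=.
    by move=> [_ _ h1 h2]; rewrite in_itv/= h1 h2.
  by rewrite in_itv/= => /andP[h1 h2]; split => //; exact: set_mem.
by rewrite lam_itv.
Qed.

(** If x and y lie in one shell about z, their distances to z differ by at most d, so [transversal]
    bounds the set of such z; for each of them r stays in an interval of length d. These are the two
    factors d. *)
Let integral_energy d : 0 < d ->
  (\int[nu]_w energy d w <= (d * (B * d))%:E * \int[mumu]_q ks q)%E.
Proof.
move=> d0; have mW := measurable_incidence d.
have -> : (\int[nu]_w energy d w = \int[mumu]_q \int[nu]_w pair_density d (w, q))%E.
  exact: (fubini_tonelli (m1 := nu) (m2 := mumu) _ (measurable_pair_density d)
    (pair_density_ge0 d)).
have dBd0 : 0 <= d * (B * d) by rewrite ltW// !mulr_gt0.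
rewrite -ge0_integralZl_EFin//.
apply: le_lower_integral => -[x y] _; first exact: integral_ge0.
pose V := ysection (W d) x `&` ysection (W d) y.
have mV : measurable V by apply: measurableI; exact: measurable_ysection.
have -> : (\int[nu]_w pair_density d (w, (x, y)) = kt (x, y) * nu V)%E.
  rewrite -[V]setIT -(integral_indic nu measurableT mV) -ge0_integralZl//; last first.
    by apply/measurable_EFinP; exact: measurable_indic.
  apply: eq_integral => w _; rewrite /pair_density /= muleC indicI /=.
  by rewrite !indicE !mem_ysection.
have [[Kx Ky]|nK] := pselect (K x /\ K y); last first.
  rewrite (_ : V = set0) ?measure0 ?mule0 ?mule_ge0 ?lee_fin//.
  rewrite -subset0 => w; rewrite /V !ysectionE => -[[_ Kx _ _] [_ Ky _ _]].
  exact: nK.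
pose Y := [set z | G z /\ (`|rad (z, x) - rad (z, y)| <= d)%R].
have mY : measurable Y.
  have mr u : measurable_fun setT (fun z => rad (z, u)) by exact: measurable_fun_pair1.
  rewrite (_ : Y = G `&` (fun z => `|rad (z, x) - rad (z, y)| <= d) @^-1` [set true]).
    apply: measurableI => //; rewrite -[X in measurable X]setTI.
    apply: measurable_fun_ler => //; apply: measurableT_comp => //.
    exact: measurable_funB.
  by apply/seteqP; split.
apply: (@le_trans _ _ (kt (x, y) * (d%:E * sg Y))%E); last first.
  rewrite muleCA EFinM -muleA; apply: lee_wpmul2l; first by rewrite lee_fin ltW.
  exact: transversal.
apply: lee_wpmul2l => //.
rewrite /nu /= /center_radius_measure /product_measure1.
apply: (@le_trans _ _ (\int[sg]_z (d%:E * (\1_Y z)%:E))%E); last first.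
  rewrite ge0_integralZl_EFin//; last first.
  - exact: ltW.
  - by apply/measurable_EFinP; exact: measurable_indic.
  by rewrite integral_indic// setIT.
apply: le_lower_integral => z _ //=.
have Vz r : xsection V z r -> [/\ G z, rad (z, x) < r <= rad (z, x) + d &
    rad (z, y) < r <= rad (z, y) + d].
  rewrite xsectionE /V !ysectionE => -[[/= ? _ h1 h2] [/= _ _ h3 h4]].
  by rewrite h1 h2 h3 h4.
have [Yz|Yz] := pselect (Y z); last first.
  rewrite (_ : xsection V z = set0) ?measure0 ?mule_ge0 ?lee_fin ?(ltW d0)//.
  rewrite -subset0 => r /Vz[Gz /andP[h1 h2] /andP[h3 h4]]; apply: Yz; split => //.
  by rewrite ler_norml; lra.
rewrite indicE mem_set// mule1.
apply: (@le_trans _ _ (lam `](rad (z, x)), (rad (z, x) + d)]%classic)).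
  apply: le_measure; rewrite ?inE//; first exact: measurable_xsection.
  by move=> r /Vz[_ h _] /=; rewrite in_itv.
by rewrite lam_itv.
Qed.

(* The quantity 2 b N - b^2 J bounds N^2 / J from below for every b, and is
   linear in the mass N and in the energy J. *)
Let lower (b d : R) (w : Omega) : \bar R :=
  maxe 0%E ((2 * b)%:E * mass d w - (b ^+ 2)%:E * energy d w)%E.

Let mass_fin d w : mass d w = (fine (mass d w))%:E.
Proof. by rewrite fineK// fin_num_measure//; exact: measurable_slab. Qed.

Let lower_ge0 b d w : (0 <= lower b d w)%E.
Proof. by rewrite /lower le_max lexx. Qed.

Let measurable_lower b d : measurable_fun setT (lower b d).
Proof.
apply: measurable_maxe; first exact: measurable_cst.
by apply: emeasurable_funB; apply: measurable_funeM.
Qed.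

Let energy_real b d w (v : R) : 0 <= v -> 0 < b -> (v%:E < lower b d w)%E ->
  exists j : R, [/\ energy d w = j%:E, 0 <= j, 0 < fine (mass d w) &
    v < 2 * b * fine (mass d w) - b ^+ 2 * j].
Proof.
move=> v0 b0; have nv : (v%:E < 0)%E = false.
  by apply/negbTE; rewrite -leNgt lee_fin.
rewrite /lower lt_max nv/= mass_fin.
case E : (energy d w) (energy_ge0 d w) => [j| |]//.
  rewrite lee_fin => j0; rewrite -!EFinM -EFinB lte_fin => h; exists j; split => //.
  have b20 : 0 <= b ^+ 2 * j by rewrite mulr_ge0// sqr_ge0.
  have : 0 < 2 * b * fine (mass d w) by lra.
  by rewrite pmulr_rgt0// mulr_gt0.
by rewrite gt0_muley ?lte_fin ?exprn_gt0// addeNy.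
Qed.

Let lower_capacity b d w (v : R) : 0 < v -> 0 < b -> (v%:E < lower b d w)%E ->
  (0 < mu (slab d w))%E /\
  (v%:E * \int[mu]_(x in slab d w) \int[mu]_(y in slab d w) kt (x, y) <=
    mu (slab d w) ^+ 2)%E.
Proof.
move=> v0 b0 vl; have [j [Ej j0 N0 vj]] := energy_real (ltW v0) b0 vl.
rewrite -energyE Ej -/(mass d w) mass_fin lte_fin; split => //.
rewrite -EFin_expe -EFinM lee_fin.
have : v * j <= (2 * b * fine (mass d w) - b ^+ 2 * j) * j by rewrite ler_wpM2r// ltW.
(* (2 b N - b^2 J) J = N^2 - (N - b J)^2. *)
have := sqr_ge0 (fine (mass d w) - b * j).
by move: (fine (mass d w)) => N; nra.
Qed.

(** Since J >= kap N^2, completing the square in b kap N gives a bound uniform in b. It dominates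
    the densities. *)
Let lower_bounded b d w : 0 < b -> (lower b d w <= kap^-1%:E)%E.
Proof.
move=> b0; rewrite leNgt; apply/negP => h.
have k0 : 0 < kap^-1 by rewrite invr_gt0.
have [j [Ej j0 N0 vj]] := energy_real (ltW k0) b0 h.
have := energy_lb d w; rewrite Ej mass_fin -EFin_expe -EFinM lee_fin => kN.
have := sqr_ge0 (1 - b * kap * fine (mass d w)).
have : b ^+ 2 * (kap * fine (mass d w) ^+ 2) <= b ^+ 2 * j by rewrite ler_wpM2l// sqr_ge0.
have : kap * kap^-1 < kap * (2 * b * fine (mass d w) - b ^+ 2 * j) by rewrite ltr_pM2l.
rewrite mulfV ?gt_eqF//.
move: (fine (mass d w)) => N h1 h2 h3.
have : kap * (b ^+ 2 * (kap * N ^+ 2)) <= kap * (b ^+ 2 * j) by rewrite ler_wpM2l// ltW.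
by lra.
Qed.

Let slab_empty d w : ~~ (0 < w.2 <= R0 + d) -> slab d w = set0.
Proof.
move=> w2; rewrite -subset0 => x; rewrite /slab xsectionE => -[/= Gz Kx h1 h2].
move/negP: w2; apply; rewrite (le_lt_trans (rad_ge0 _) h1)/= (le_trans h2)// lerD2r.
exact: radKG.
Qed.

Let lower_support b d w : ~~ (0 < w.2 <= R0 + d) -> lower b d w = 0%E.
Proof.
move=> /slab_empty w0; rewrite /lower /mass w0 measure0 mule0 add0e.
apply/max_idPl; rewrite leeNl oppe0 mule_ge0// lee_fin sqr_ge0//.
Qed.

(** The term b^2 J is added to both sides rather than subtracted under the integral, since J may be
    infinite at some w. *)
Let integral_lower b d (I : R) : 0 < b -> 0 < d -> (\int[mumu]_q ks q = I%:E)%E ->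
  (((2 * b * d)%:E * sg G - (b ^+ 2 * (d * (B * d)) * I)%:E)%E <= \int[nu]_w lower b d w)%E.
Proof.
move=> b0 d0 ksI; rewrite leeBlDr//.
apply: (@le_trans _ _ (\int[nu]_w (lower b d w + (b ^+ 2)%:E * energy d w))%E); last first.
  have b20 : 0 <= b ^+ 2 by rewrite sqr_ge0.
  rewrite ge0_integralD//; last 2 first.
  - by move=> w _; rewrite mule_ge0// lee_fin.
  - exact: measurable_funeM.
  have -> : ((b ^+ 2 * (d * (B * d)) * I)%:E = (b ^+ 2)%:E * (d * (B * d) * I)%:E)%E.
    by rewrite -EFinM -mulrA.
  apply: leeD2l; rewrite ge0_integralZl_EFin//; apply: lee_wpmul2l => //.
  by apply: (le_trans (integral_energy d0)); rewrite ksI.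
apply: (@le_trans _ _ (\int[nu]_w ((2 * b)%:E * mass d w))%E).
  have b20 : 0 <= 2 * b by rewrite mulr_ge0// ltW.
  rewrite ge0_integralZl_EFin// EFinM -muleA; apply: lee_wpmul2l => //.
  exact: integral_mass.
apply: le_lower_integral => w _; first by rewrite mule_ge0// lee_fin mulr_ge0// ltW.
case E : (energy d w) (energy_ge0 d w) => [j| |]//.
  move=> _; rewrite -leeBlDr// /lower E le_max lexx orbT//.
move=> _; rewrite gt0_muley ?lte_fin ?exprn_gt0// addey ?leey//.
by rewrite gt_eqF// (lt_le_trans _ (lower_ge0 _ _ _)).
Qed.

Let width (j : nat) : R := j.+1%:R^-1.

Let width_gt0 j : 0 < width j. Proof. by rewrite invr_gt0. Qed.

Let width_le1 j : width j <= 1.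
Proof. by rewrite invf_le1// ler1n. Qed.

Let density (beta : R) (w : Omega) (j : nat) : \bar R :=
  lower (beta / width j) (width j) w.

Let limit_density beta w := limn_esup (density beta w).

Let density_ge0 beta w n : (0 <= esups (density beta w) n)%E.
Proof.
apply: (@le_trans _ _ (density beta w n)); first exact: lower_ge0.
by apply: ereal_sup_ubound; exists n => /=.
Qed.

Let window := ([set: Z] `*` `]0, (R0 + 1)]%classic) : set Omega.

Let measurable_window : measurable window.
Proof. exact: measurableX. Qed.

Let density_dominated beta w n : 0 < beta ->
  (`|esups (density beta w) n| <= kap^-1%:E * (\1_window w)%:E)%E.
Proof.
move=> beta0; rewrite gee0_abs; last exact: density_ge0.
apply: ge_ereal_sup => _ [j /= _ <-]; rewrite /density indicE.
have [|nw] := boolP (w \in window).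
  by move=> _; rewrite mule1; apply: lower_bounded; rewrite divr_gt0.
rewrite mule0 lower_support//; apply: contra nw => /andP[w0 wR].
rewrite inE; split => //=; rewrite in_itv/= w0/= (le_trans wR)// lerD2l.
exact: width_le1.
Qed.

Let measurable_limit_density beta : measurable_fun setT (limit_density beta).
Proof.
apply: measurable_fun_limn_esup => j; exact: measurable_lower.
Qed.

Let limit_density_ge0 beta w : (0 <= limit_density beta w)%E.
Proof.
rewrite /limit_density limn_esup_lim; apply: lime_ge; first exact: is_cvg_esups.
by apply: nearW => n; exact: density_ge0.
Qed.

Let limit_density_support beta w : w.2 <= 0 -> limit_density beta w = 0%E.
Proof.
move=> w0; rewrite /limit_density limn_esup_lim.
rewrite (_ : esups (density beta w) = cst 0%E); first exact: lim_cst.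
apply/funext => n; apply/eqP; rewrite eq_le density_ge0 andbT.
apply: ge_ereal_sup => _ [j /= _ <-]; rewrite /density lower_support//.
by rewrite ltNge w0.
Qed.

(** Reverse Fatou: dominated convergence for the tail suprema, which vanish off a window of finite
    measure. With b times the width equal to beta, the lower bound is the same at every step. *)
Let integral_limit_density beta (I : R) : 0 < beta -> (\int[mumu]_q ks q = I%:E)%E ->
  ((2 * beta)%:E * sg G - (beta ^+ 2 * B * I)%:E <=
    \int[nu]_w limit_density beta w)%E.
Proof.
move=> beta0 ksI; have k0 : 0 <= kap^-1 by rewrite invr_ge0 ltW.
have mu_ n : measurable_fun setT (fun w => esups (density beta w) n).
  by apply: measurable_fun_esups => j; exact: measurable_lower.
have mI : measurable_fun setT (fun w => (\1_window w)%:E : \bar R).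
  by apply/measurable_EFinP; exact: measurable_indic.
have int_g : nu.-integrable setT (fun w => kap^-1%:E * (\1_window w)%:E)%E.
  apply: integrableZl => //; apply/integrableP; split => //.
  under eq_integral do rewrite gee0_abs ?lee_fin//.
  rewrite integral_indic// setIT /nu /= /center_radius_measure product_measure1E//.
  rewrite lte_mul_pinfty//; first by rewrite fin_num_measure.
  by rewrite /lam /= lebesgue_measure_itv/=; case: ifP => // _; rewrite -EFinD ltry.
have [] := @dominated_convergence _ _ R nu setT measurableT
  (fun n w => esups (density beta w) n) (limit_density beta) _ mu_
  (measurable_limit_density beta) _ int_g _.
- apply: aeW => w _; rewrite /limit_density limn_esup_lim; exact: is_cvg_esups.
- by apply: aeW => w n _; exact: density_dominated.
move=> _ _ cv; rewrite -(cvg_lim _ cv)//; apply: lime_ge; first by apply/cvg_ex; eexists; exact: cv.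
apply: nearW => n.
have w0 := width_gt0 n; have b0 : 0 < beta / width n by rewrite divr_gt0.
apply: (le_trans _ (le_trans (integral_lower b0 w0 ksI) _)).
  have -> : 2 * (beta / width n) * width n = 2 * beta by field; rewrite gt_eqF.
  have -> // : (beta / width n) ^+ 2 * (width n * (B * width n)) = beta ^+ 2 * B.
  by field; rewrite gt_eqF.
apply: le_lower_integral => w _; first exact: lower_ge0.
by apply: ereal_sup_ubound; exists n => /=.
Qed.

(** No measurability of h is assumed. What is asked is that h (z, r) exceed every v certified by
    shells of arbitrarily small width, the form in which weak limits bound the capacity. *)
Lemma slice_integral_ge (h : Z -> R -> \bar R) (beta I : R) :
  0 < beta -> (\int[mu \x mu]_q ks q = I%:E)%E ->
  (forall z r, (0 <= h z r)%E) ->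
  (forall z r v, 0 < r -> 0 < v ->
    (forall n, exists2 d, 0 < d <= n.+1%:R^-1 &
      (0 < mu (slab d (z, r)))%E /\
      (v%:E * \int[mu]_(x in slab d (z, r)) \int[mu]_(y in slab d (z, r)) kt (x, y) <=
        mu (slab d (z, r)) ^+ 2)%E) -> (v%:E <= h z r)%E) ->
  ((2 * beta)%:E * sg G - (beta ^+ 2 * B * I)%:E <=
    \int[sg]_z \int[@lebesgue_measure R]_(r in `]0%R, +oo[) h z r)%E.
Proof.
move=> beta0 ksI h0 hv.
apply: (le_trans (integral_limit_density beta0 ksI)).
have -> : (\int[nu]_w limit_density beta w =
    \int[sg]_z \int[lam]_r limit_density beta (z, r))%E.
  exact: (fubini_tonelli1 (m1 := sg) (m2 := lam) _ (measurable_limit_density beta)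
    (fun w => limit_density_ge0 beta w)).
apply: le_lower_integral => z _; first exact: integral_ge0.
rewrite [leRHS]integral_mkcond; apply: le_lower_integral => r _ //.
rewrite patchE; case: ifPn => [|/negP r0]; last first.
  rewrite limit_density_support//= leNgt; apply/negP => r0'; apply: r0.
  by rewrite inE /= in_itv/= r0'.
rewrite inE /= in_itv/= andbT => r0.
rewrite leNgt; apply/negP => hg.
have [v hv' vg] : exists2 v : R, (h z r < v%:E)%E & (v%:E < limit_density beta (z, r))%E.
  move: hg (h0 z r); case: (h z r) => [H| |]//; case: (limit_density _ _) => [L| |]//.
    rewrite lte_fin => HL _; exists ((H + L) / 2); rewrite lte_fin; lra.
  by move=> _ _; exists (H + 1); rewrite ?lte_fin ?ltry// ltrDl.
have v0 : 0 < v by rewrite -lte_fin (le_lt_trans (h0 z r)).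
move: hv'; rewrite ltNge => /negP; apply; apply: hv => // n.
(* The upper limit is the infimum of the tail suprema, so each tail has a shell whose density
   exceeds v. *)
have : (v%:E < esups (density beta (z, r)) n)%E.
  apply: (lt_le_trans vg); rewrite /limit_density limn_esup_lim.
  have /cvg_lim ->// := @cvg_esups_inf R (density beta (z, r)).
  by apply: ereal_inf_lbound; exists n.
move=> /ereal_sup_gt[_ [j /= nj <-]] vj; exists (width j).
  by rewrite width_gt0/= lef_pV2 ?posrE// ler_nat ltnS.
by apply: lower_capacity vj => //; rewrite divr_gt0.
Qed.

End radial_slices.

Section capacity_of_slices.
Context {R : realType} {m : nat}.

Variables (s a R0 B : R) (K : set 'rV[R]_m) (G : set (borelRV R m)).
Variable sg : {finite_measure set (borelRV R m) -> \bar R}.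
Hypothesis s1 : 1 < s.
Hypothesis cK : compact K.
Hypothesis mG : measurable G.
Hypothesis a0 : 0 < a.
Hypothesis Ka : forall x y, K x -> K y -> enorm (x - y) <= a.
Hypothesis KG : forall (x z : 'rV[R]_m), K x -> G z -> enorm (x - z) <= R0.
Hypothesis B0 : 0 < B.
Hypothesis transversal : forall (x y : 'rV[R]_m) (d : R), K x -> K y -> x != y -> 0 < d ->
  (sg [set z : 'rV[R]_m | G z /\ (`|enorm (x - z) - enorm (y - z)| <= d)%R] <=
    (B * (d / enorm (x - y)))%:E)%E.

Local Notation slices := (\int[sg]_z \int[@lebesgue_measure R]_(r in `]0%R, +oo[)
  Cap (s - 1) (K `&` esphere z r))%E.

Let rad (p : borelRV R m * borelRV R m) : R := enorm ((p.2 : 'rV[R]_m) - p.1).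

Let kernel_transversal (x y : 'rV[R]_m) (d : R) : K x -> K y -> 0 < d ->
  (riesz_kernel (s - 1) x y *
    sg [set z | G z /\ (`|rad (z, x) - rad (z, y)| <= d)%R] <=
    (B * d)%:E * riesz_kernel s x y)%E.
Proof.
move=> Kx Ky d0; have [xy|xy] := eqVneq x y.
  by rewrite [in leRHS]/riesz_kernel xy eqxx gt0_muley ?leey// lte_fin mulr_gt0.
have xy0 : 0 < enorm (x - y).
  rewrite lt_neqAle enorm_ge0 andbT eq_sym; apply: contra_neq xy => /enorm_eq0/eqP.
  by rewrite subr_eq0 => /eqP.
have := transversal Kx Ky xy d0; rewrite /rad /= => h.
apply: (le_trans (lee_wpmul2l (riesz_kernel_ge0 _ _ _) h)).
rewrite /riesz_kernel (negbTE xy) -!EFinM lee_fin.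
rewrite (_ : - s = - (s - 1) + -1); last by ring.
rewrite powRD; last by apply/implyP => _; rewrite gt_eqF.
rewrite [_ `^ -1]powRN powRr1 ?enorm_ge0//.
by rewrite le_eqVlt; apply/predU1P; left; field; rewrite gt_eqF.
Qed.

Lemma energy_slices (mu : probability (borelRV R m) R) (beta I : R) : 0 < beta ->
  mu (~` K) = 0%E -> riesz_energy s mu = I%:E ->
  ((2 * beta)%:E * sg G - (beta ^+ 2 * B * I)%:E <= slices)%E.
Proof.
have s0 : 0 < s by apply: lt_trans s1.
have s10 : 0 < s - 1 by rewrite subr_gt0.
move=> beta0 muK; rewrite riesz_energyE// => EI.
have mK : measurable (K : set (borelRV R m)).
  by apply: closed_measurable_rV; exact: compact_closed_rV.
have a's : 0 < a `^ - (s - 1) by rewrite powR_gt0.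
pose kt (p : borelRV R m * borelRV R m) := riesz_kernel (s - 1) p.1 p.2.
pose ks (p : borelRV R m * borelRV R m) := riesz_kernel s p.1 p.2.
have mrad : measurable_fun setT rad by exact: measurable_enormB.
have mkt : measurable_fun setT kt by exact: measurable_riesz_kernel.
have mks : measurable_fun setT ks by exact: measurable_riesz_kernel.
have kt0 p : (0 <= kt p)%E by exact: riesz_kernel_ge0.
have ks0 p : (0 <= ks p)%E by exact: riesz_kernel_ge0.
have kapK x y : K x -> K y -> ((a `^ - (s - 1))%:E <= kt (x, y))%E.
  by move=> Kx Ky; apply: riesz_kernel_lb => //; exact: Ka.
apply: (slice_integral_ge mrad mkt mks kt0 ks0 mK mG muK a's kapK
  (fun z x Gz Kx => KG Kx Gz) (fun p => enorm_ge0 _) B0 kernel_transversal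
  (h := fun z r => Cap (s - 1) (K `&` esphere z r)) beta0 EI).
  by move=> z r; exact: Cap_ge0.
move=> z r v r0 v0 hd.
have {hd} /choice[d hd] : forall n, exists d, 0 < d <= n.+1%:R^-1 /\
    ((0 < mu (slab rad K G d (z, r)))%E /\
      (v%:E * \int[mu]_(x in slab rad K G d (z, r))
        \int[mu]_(y in slab rad K G d (z, r)) kt (x, y) <=
        mu (slab rad K G d (z, r)) ^+ 2)%E).
  by move=> n; have [d ? ?] := hd n; exists d.
have slabE n (x : 'rV[R]_m) : slab rad K G (d n) (z, r) x ->
    K x /\ enorm (x - z) < r <= enorm (x - z) + d n.
  by rewrite /slab xsectionE => -[_ Kx h1 h2]; rewrite h1 h2.
apply: (@Cap_limit_ge _ _ (s - 1) v K _ mu (fun n => slab rad K G (d n) (z, r))) => //.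
- by move=> n; exact: measurable_slab.
- by move=> n x /slabE[].
- by move=> n; have [_ []] := hd n.
- by move=> n; have [_ []] := hd n.
have half_gt0 (e : R) : 0 < e -> 0 < e / 2 by move=> e0; rewrite divr_gt0.
move=> x hx; split.
  apply: (compact_closed_rV cK) => U /nbhs_eball[e e0 eU].
  have [n _ [y /slabE[Ky _] xy]] := hx _ 0%N (half_gt0 e e0).
  exists y; split => //; apply: eU; rewrite /eball/= enormC (le_lt_trans xy)//.
  lra.
apply: esphere_superset => //=; apply/eqP; rewrite -subr_eq0 -normr_le0.
apply/ler_addgt0Pr => e e0; rewrite add0r.
(* From this index on the shell width is at most e / 2; with y within e / 2 of x, this leaves | |x -
   z| - r | <= e. *)
have [n nk [y /slabE[_ yr] xy]] := hx _ (Num.truncn (2 / e)) (half_gt0 e e0).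
have dn : d n <= e / 2.
  have [/andP[_ dn] _] := hd n; apply: (le_trans dn).
  rewrite -[e / 2]invrK lef_pV2 ?posrE ?invr_gt0 ?divr_gt0// invf_div.
  by rewrite ltW// (lt_le_trans (truncnS_gt _))// ler_nat ltnS.
have := enorm_triangle y x z; have := enorm_triangle x y z.
rewrite [enorm (y - x)]enormC; case/andP: yr => y1 y2 t1 t2.
by rewrite ler_norml; apply/andP; split; lra.
Qed.

Lemma Cap_slices : (Cap s K * sg G ^+ 2 <= B%:E * slices)%E.
Proof.
have sl0 : (0 <= slices)%E.
  by apply: integral_ge0 => z _; apply: integral_ge0 => r _; exact: Cap_ge0.
have [h sgh] : exists h, sg G = h%:E.
  by exists (fine (sg G)); rewrite fineK// fin_num_measure.
rewrite sgh; have [->|hN0] := eqVneq h 0; first by rewrite expe2 mule0 mule0 mule_ge0// lee_fin ltW.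
have h0 : 0 < h by rewrite lt_neqAle eq_sym hN0 -lee_fin -sgh measure_ge0.
have h20 : 0 < h ^+ 2 by rewrite exprn_gt0.
move: sl0 (@energy_slices); case: slices => [V| |]//; last first.
  by move=> _ _; rewrite gt0_muley ?lte_fin// leey.
rewrite lee_fin => V0; have V2 : V < 2 * (V + 1) by lra.
move=> hV; rewrite -EFin_expe -lee_pdivlMr// -!EFinM.
apply: Cap_le; first by rewrite lee_fin divr_ge0 ?mulr_ge0// ltW.
move=> mu muK; case E : (riesz_energy s mu) (riesz_energy_ge0 s mu) => [I| |]//; last first.
  by move=> _; rewrite invey lee_fin divr_ge0 ?mulr_ge0// ltW.
rewrite lee_fin le_eqVlt => /predU1P[I0|I0].
  (* Zero energy would make the capacity infinite. It is impossible: the lower bound is then linear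
     in beta, and this beta makes it 2 (V + 1) > V. *)
  have bp : 0 < (V + 1) / h by rewrite divr_gt0// ltr_wpDl.
  have := hV mu _ _ bp muK E; rewrite sgh -I0 -EFinM -EFinB lee_fin.
  have -> : 2 * ((V + 1) / h) * h - ((V + 1) / h) ^+ 2 * B * 0 = 2 * (V + 1).
    by field; rewrite gt_eqF.
  by rewrite leNgt V2.
rewrite inver gt_eqF// lee_fin ler_pdivlMr//.
(* The maximizer of 2 beta h - beta^2 B I, with maximum h^2 / (B I). *)
have bp : 0 < h / (B * I) by rewrite divr_gt0// mulr_gt0.
have := hV mu _ _ bp muK E; rewrite sgh -EFinM -EFinB lee_fin.
have -> : 2 * (h / (B * I)) * h - (h / (B * I)) ^+ 2 * B * I = B^-1 * (I^-1 * h ^+ 2).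
  by field; rewrite !gt_eqF.
by rewrite mulrC ler_pdivrMr// mulrC [V * B]mulrC.
Qed.

End capacity_of_slices.

Theorem proposition1p3 (R : realType) (n : nat) (hn : (1 <= n)%N)
    (tau : R) (htau : 0 < tau) :
  exists2 C : R, 0 < C &
    forall (r0 : R) (Gamma : set 'rV[R]_(n + 1)) (c : 'rV[R]_(n + 1)) (rho : R)
           (K G : set 'rV[R]_(n + 1)) (s : R),
      0 < r0 ->
      lipschitz_graph tau Gamma -> Gamma 0 ->
      0 < rho -> rho <= r0 / 10 ->
      eball c rho `<=` eball 0 r0 ->
      ((100 * tau * r0)%:E <= set_dist (eball c rho) Gamma)%E ->
      compact K -> K `<=` eball c rho ->
      compact G -> G `<=` Gamma `&` eball 0 r0 ->
      1 < s ->
      (Cap s K * (hausdorff n G ^+ 2 / (r0 ^+ n)%:E) <=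
       C%:E * \int[@hausdorff R (n + 1) n]_(z in G)
                \int[@lebesgue_measure R]_(r in `]0%R, +oo[)
                   Cap (s - 1)%R (K `&` esphere z r))%E.
Proof.
case: n hn => // k _; have [C C0 HC] := @transversality R k tau htau; exists C => //.
move=> r0 Gamma c rho K G s r00 lipG _ rho0 _ cr0 distG cK KB cG GG s1.
have [HG tr] := HC _ _ _ _ r00 lipG rho0 cr0 distG G GG.
have mG : measurable (G : set (borelRV R (k.+1 + 1))).
  by apply: closed_measurable_rV; exact: compact_closed_rV.
have Gfin : (@hausdorff R (k.+1 + 1) k.+1 G < +oo)%E by rewrite (le_lt_trans HG) ?ltry.
(* Slicing is applied to Hausdorff measure restricted to G, a finite measure, with B = C r0^n. The
   power of r0 in B is the one by which the statement divides. *)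
pose sg : {finite_measure set (borelRV R (k.+1 + 1)) -> \bar R} := mfrestr mG Gfin.
have sgE A : sg A = hausdorff k.+1 (A `&` G) by [].
have rk0 : 0 < r0 ^+ k.+1 by rewrite exprn_gt0.
have a0 : 0 < rho + rho by rewrite addr_gt0.
have Ka x y : K x -> K y -> enorm (x - y) <= rho + rho.
  move=> /KB xc /KB yc; apply: (le_trans (enorm_triangle c _ _)).
  by rewrite lerD// ltW// enormC.
have KG (x z : 'rV[R]_(k.+1 + 1)) : K x -> G z -> enorm (x - z) <= r0 + r0.
  move=> /KB/cr0 x0 /GG[_ z0]; apply: (le_trans (enorm_triangle 0 _ _)).
  by rewrite lerD// ltW// enormC.
have B0 : 0 < C * r0 ^+ k.+1 by rewrite mulr_gt0.
have trs x y (d : R) : K x -> K y -> x != y -> 0 < d ->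
    (sg [set z : 'rV[R]_(k.+1 + 1) | G z /\ (`|enorm (x - z) - enorm (y - z)| <= d)%R] <=
      (C * r0 ^+ k.+1 * (d / enorm (x - y)))%:E)%E.
  move=> Kx Ky xy d0; rewrite sgE; apply: (le_trans _ (tr x y d _ _ xy d0)); last 2 first.
  - exact: KB.
  - exact: KB.
  by apply: le_outer_measure => z [].
have := Cap_slices s1 cK mG a0 Ka KG B0 trs; rewrite sgE setIid => main.
rewrite inver (gt_eqF rk0) muleA (lee_pdivrMr _ _ rk0); apply: (le_trans main).
rewrite EFinM -!muleA; apply: lee_wpmul2l; first by rewrite lee_fin ltW.
rewrite muleC; apply: lee_wpmul2r; first by rewrite lee_fin ltW.
apply: le_integral_mrestr => z; apply: integral_ge0 => r _; exact: Cap_ge0.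
Qed.
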